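(* Let $\lambda_1=\lambda_2>0$ and $\beta>\tfrac12$. Then the system $$ \begin{cases} -u''+\lambda_1 u = u^3+\beta uv,\\ -v''+\lambda_2 v = \tfrac12 v^2+\tfrac12\beta u^2, \end{cases} \qquad x\in\mathbb{R}, $$ has a ground state.
   Context: $E=W^{1,2}(\mathbb{R})$ (real-valued functions), $\mathbb{E}=E\times E$, with elements $\mathbf u=(u,v)$ and $\mathbf 0=(0,0)$. For $j=1,2$, $\|u\|_j^2=\int_{\mathbb{R}}(|u'|^2+\lambda_j u^2)\,dx$, and $\|\mathbf u\|^2=\|u\|_1^2+\|v\|_2^2$. The energy functional $\Phi:\mathbb{E}\to\mathbb{R}$ associated with the system is $$\Phi(\mathbf u)=\tfrac12\|u\|_1^2-\tfrac14\int_{\mathbb{R}}u^4\,dx+\tfrac12\|v\|_2^2-\tfrac16\int_{\mathbb{R}}v^3\,dx-\tfrac12\beta\int_{\mathbb{R}}u^2v\,dx .$$ A non-trivial bound state of the system is a critical point $\mathbf u\in\mathbb{E}\setminus\{\mathbf 0\}$ of $\Phi$. A ground state is a non-trivial bound state $\tilde{\mathbf u}$ of minimal energy among all non-trivial bound states: $$\Phi(\tilde{\mathbf u})=\min\{\Phi(\mathbf u):\mathbf u\in\mathbb{E}\setminus\{\mathbf 0\},\ \Phi'(\mathbf u)=0\}.$$ *)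

(* Defs.v *)
From HB Require Import structures.
From mathcomp Require Import all_boot all_order all_algebra.
From mathcomp Require Import all_classical all_reals all_analysis.

Set Implicit Arguments.
Unset Strict Implicit.
Unset Printing Implicit Defensive.

Import Order.TTheory GRing.Theory Num.Def Num.Theory.
Import numFieldNormedType.Exports.

Local Open Scope classical_set_scope.
Local Open Scope ring_scope.

(* Elements of W^{1,2}(R) are handled through representatives: functions on R,
   two of which stand for the same element when they agree almost everywhere.
   For Borel functions, everything below depends only on the a.e. class. *)

Section Sobolev.
Context {R : realType}.
Local Notation mu := (@lebesgue_measure R).

(* the space C_c^oo(R) *)
Definition test_function (phi : R -> R) : Prop :=
  (forall (n : nat) (x : R), derivable (derive1n n phi) x 1) /\
  compact (closure [set x | phi x != 0]).

Definition is_weak_derivative (u g : R -> R) : Prop :=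
  forall phi : R -> R, test_function phi ->
    \int[mu]_x (u x * derive1 phi x) = - \int[mu]_x (g x * phi x).

Definition W12 : set (R -> R) :=
  [set u | u \in Lfun mu 2%:E /\
           exists2 g, g \in Lfun mu 2%:E & is_weak_derivative u g].

(* For u in W12, a representative of the (a.e. unique) weak derivative of u;
   the default value 0 is only taken outside W12. *)
Definition wderiv (u : R -> R) : R -> R :=
  xget (cst 0) [set g | g \in Lfun mu 2%:E /\ is_weak_derivative u g].

Definition sqnorm (lambda : R) (u : R -> R) : R :=
  \int[mu]_x (wderiv u x ^+ 2 + lambda * u x ^+ 2).

Definition EE : set ((R -> R) * (R -> R)) := W12 `*` W12.

Definition null_pair (w : (R -> R) * (R -> R)) : Prop :=
  ae_eq mu setT w.1 (cst 0) /\ ae_eq mu setT w.2 (cst 0).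

Definition normEE (lambda1 lambda2 : R) (w : (R -> R) * (R -> R)) : R :=
  Num.sqrt (sqnorm lambda1 w.1 + sqnorm lambda2 w.2).

Definition Phi (lambda1 lambda2 beta : R) (w : (R -> R) * (R -> R)) : R :=
  let u := w.1 in let v := w.2 in
  2^-1 * sqnorm lambda1 u - 4^-1 * \int[mu]_x (u x ^+ 4)
  + 2^-1 * sqnorm lambda2 v - 6^-1 * \int[mu]_x (v x ^+ 3)
  - 2^-1 * beta * \int[mu]_x (u x ^+ 2 * v x).

Definition bounded_linear_EE (N L : (R -> R) * (R -> R) -> R) : Prop :=
  (forall (a : R) h k, EE h -> EE k ->
     L (fun x => a * h.1 x + k.1 x, fun x => a * h.2 x + k.2 x) = a * L h + L k) /\
  (exists C : R, forall h, EE h -> `|L h| <= C * N h).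

(* F is regarded as a functional on EE, normed by N, with Frechet derivative
   L at w. *)
Definition is_frechet_derivative
    (N F : (R -> R) * (R -> R) -> R) (w : (R -> R) * (R -> R))
    (L : (R -> R) * (R -> R) -> R) : Prop :=
  bounded_linear_EE N L /\
  forall eps : R, 0 < eps -> exists2 delta : R, 0 < delta &
    forall h, EE h -> N h < delta -> `|F (w + h) - F w - L h| <= eps * N h.

Definition bound_state (lambda1 lambda2 beta : R)
    (w : (R -> R) * (R -> R)) : Prop :=
  [/\ EE w, ~ null_pair w &
      is_frechet_derivative (normEE lambda1 lambda2)
        (Phi lambda1 lambda2 beta) w (fun=> 0)].

Definition ground_state (lambda1 lambda2 beta : R)
    (w : (R -> R) * (R -> R)) : Prop :=
  bound_state lambda1 lambda2 beta w /\
  forall z, bound_state lambda1 lambda2 beta z ->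
    Phi lambda1 lambda2 beta w <= Phi lambda1 lambda2 beta z.

End Sobolev.

(* Main.v *)
Require Import Defs.
From mathcomp Require Import all_boot all_order all_algebra.
From mathcomp Require Import all_classical all_reals all_analysis.
From mathcomp Require Import measurable_realfun.
From mathcomp Require Import ring lra.

Import Order.TTheory GRing.Theory Num.Def Num.Theory.
Import numFieldNormedType.Exports.

Set Implicit Arguments.
Unset Strict Implicit.
Unset Printing Implicit Defensive.

Local Open Scope classical_set_scope.
Local Open Scope ring_scope.

(* In dimension one no mountain pass is needed: the energy can be minimised over
   the set of bound states itself.  A bound state solves the system weakly, hence,
   after modification on a null set, it is a classical solution (U, V) of an
   autonomous ordinary differential equation on the line, and
   Phi = Phi - Phi'(u)u / 3 is the integral of the nonnegative density
   e = (U'^2 + V'^2 + lambda (U^2 + V^2)) / 6 + U^4 / 12.  Since |(U^2)'|, U^2,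
   |(U'^2)'|, ... are bounded by multiples of e, a bound on the energy bounds U, U',
   V and V' uniformly.  Testing the equation with the solution itself gives a
   constant d > 0 such that U^2 + V^2 >= d somewhere, and a translation brings this
   point to 0.  Along a minimising sequence, the translated solutions, together with
   a primitive Psi of e, converge pointwise along an ultrafilter; the second order
   Taylor estimates pass to the limit, so that the limit is again a solution, with
   Psi' = e and oscillation of Psi at most the infimum m of the energies.  It is
   nonzero because of d, and it is a bound state of energy at most m.  Finally the
   set of bound states is not empty: take u = 0 and v = 3 lambda sech^2. *)

(** * Integrable and square integrable functions *)

(** The obstacle is invariance under translation: a minimising sequence may drift away or flatten,
    and a weak limit may lose its mass. Among solutions of the differential equation local
    convergence is enough, and the only global information to be kept is the energy bound. [Psi]
    carries it: a bound on [Psi x - Psi y] involves two points at a time, so it passes to pointwise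
    limits without any convergence theorem for integrals, and it gives back the integrability of the
    density in the limit. The ultrafilter replaces a diagonal extraction: it makes bounded sequences
    converge at all points at once, and uniform bounds on second derivatives then identify the
    derivatives of the limits. The definitions speak of representatives and weak derivatives, so two
    bridges are needed. A weak derivative is turned into an almost everywhere primitive by testing
    with smooth steps at Lebesgue points; conversely, a classical solution of finite energy is
    paired with arbitrary Sobolev functions by means of cutoffs. *)

Section integrable_functions.
Context {R : realType}.
Local Notation mu := (@lebesgue_measure R).
Implicit Types f g h : R -> R.

Definition aev (P : R -> Prop) : Prop := \forall x \ae mu, P x.

Lemma ae_all (P : R -> Prop) : (forall x, P x) -> aev P.
Proof. by move=> aP; apply: aeW. Qed.

Lemma ae_mono (P Q : R -> Prop) : aev P -> (forall x, P x -> Q x) -> aev Q.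
Proof.
move=> aP PQ; apply: (@filterS _ _ (ae_filter_ringOfSetsType mu) P Q PQ).
exact: aP.
Qed.

Lemma ae_and (P Q : R -> Prop) : aev P -> aev Q -> aev (fun x => P x /\ Q x).
Proof.
move=> aP aQ; exact: (@filterI _ _ (ae_filter_ringOfSetsType mu) P Q).
Qed.

Lemma ae_foralln_imp (P : nat -> R -> Prop) : (forall n, aev (P n)) ->
  aev (fun x => forall n, P n x).
Proof. exact: ae_foralln. Qed.

Definition L1 f := mu.-integrable setT (EFin \o f).
Definition L2 f := measurable_fun setT f /\ L1 (fun x => f x ^+ 2).

Lemma L1_meas f : L1 f -> measurable_fun setT f.
Proof. by move=> /measurable_int/measurable_EFinP. Qed.

Lemma L1D f g : L1 f -> L1 g -> L1 (fun x => f x + g x).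
Proof. by move=> lf lg; have := integrableD measurableT lf lg. Qed.

Lemma L1B f g : L1 f -> L1 g -> L1 (fun x => f x - g x).
Proof. by move=> lf lg; have := integrableB measurableT lf lg. Qed.

Lemma L1Z (c : R) f : L1 f -> L1 (fun x => c * f x).
Proof. by move=> lf; have := integrableZl measurableT c lf. Qed.

Lemma L1N f : L1 f -> L1 (fun x => - f x).
Proof. by move=> lf; have := integrableN lf. Qed.

Lemma L1_norm f : L1 f -> L1 (fun x => `|f x|).
Proof. exact: integrable_norm. Qed.

Lemma L1_ae_dom f g : measurable_fun setT f -> L1 g ->
  aev (fun x => `|f x| <= g x) -> L1 f.
Proof.
move=> mf lg fg; apply/integrableP; split; first exact/measurable_EFinP.
have /integrableP[mg] := lg; apply: le_lt_trans.
have mnf : measurable_fun setT (fun x => `|(EFin \o f) x|%E).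
  by apply: measurableT_comp => //; exact/measurable_EFinP.
apply: ae_ge0_le_integral => //.
  by apply: measurableT_comp => //; exact: mg.
apply: (ae_mono fg) => x + _; rewrite /= lee_fin.
by move=> /le_trans; apply; exact: ler_norm.
Qed.

Lemma L1_dom f g : measurable_fun setT f -> L1 g ->
  (forall x, `|f x| <= g x) -> L1 f.
Proof. by move=> mf lg fg; apply: L1_ae_dom lg _ => //; exact: ae_all. Qed.

Lemma L1_ae_eq f g : measurable_fun setT g -> L1 f ->
  aev (fun x => f x = g x) -> L1 g.
Proof.
move=> mg lf fg; apply: (L1_ae_dom mg (L1_norm lf)).
by apply: (ae_mono fg) => x ->.
Qed.

Lemma Rint_ae_eq f g : measurable_fun setT f -> measurable_fun setT g ->
  aev (fun x => f x = g x) -> \int[mu]_x f x = \int[mu]_x g x.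
Proof.
move=> mf mg fg; rewrite /Rintegral; congr fine; apply: ae_eq_integral => //.
- exact/measurable_EFinP.
- exact/measurable_EFinP.
- by apply: (ae_mono fg) => x /= -> _.
Qed.

Lemma Rint_add f g : L1 f -> L1 g ->
  \int[mu]_x (f x + g x) = \int[mu]_x f x + \int[mu]_x g x.
Proof. exact: RintegralD. Qed.

Lemma Rint_sub f g : L1 f -> L1 g ->
  \int[mu]_x (f x - g x) = \int[mu]_x f x - \int[mu]_x g x.
Proof. exact: RintegralB. Qed.

Lemma Rint_scale (c : R) f : L1 f -> \int[mu]_x (c * f x) = c * \int[mu]_x f x.
Proof. exact: RintegralZl. Qed.

Lemma Rint_opp f : L1 f -> \int[mu]_x (- f x) = - \int[mu]_x f x.
Proof.
move=> lf; rewrite -mulN1r -Rint_scale//; apply: eq_Rintegral => x _.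
by rewrite mulN1r.
Qed.

Lemma Rint_ge0 f : (forall x, 0 <= f x) -> 0 <= \int[mu]_x f x.
Proof. by move=> f0; apply: Rintegral_ge0. Qed.

Lemma Rint_ae_ge0 f : measurable_fun setT f ->
  aev (fun x => 0 <= f x) -> 0 <= \int[mu]_x f x.
Proof.
move=> mf f0; rewrite (@Rint_ae_eq f (fun x => `|f x|)) //.
- by apply: Rint_ge0 => x.
- exact: measurableT_comp.
- by apply: (ae_mono f0) => x /ger0_norm.
Qed.

Lemma Rint_ae_le f g : L1 f -> L1 g -> aev (fun x => f x <= g x) ->
  \int[mu]_x f x <= \int[mu]_x g x.
Proof.
move=> lf lg fg; rewrite -subr_ge0 -Rint_sub//; apply: Rint_ae_ge0.
  exact: L1_meas (L1B lg lf).
by apply: (ae_mono fg) => x; rewrite subr_ge0.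
Qed.

Lemma Rint_le f g : L1 f -> L1 g -> (forall x, f x <= g x) ->
  \int[mu]_x f x <= \int[mu]_x g x.
Proof. by move=> lf lg fg; apply: Rint_ae_le => //; exact: ae_all. Qed.

Lemma Rint_norm f : L1 f -> `|\int[mu]_x f x| <= \int[mu]_x `|f x|.
Proof. exact: le_normr_Rintegral. Qed.

Lemma Rint_norm_le f g : L1 f -> L1 g -> aev (fun x => `|f x| <= g x) ->
  `|\int[mu]_x f x| <= \int[mu]_x g x.
Proof.
move=> lf lg fg; apply: le_trans (Rint_norm lf) _.
by apply: Rint_ae_le => //; exact: L1_norm.
Qed.

Lemma Rint_eq0 f : L1 f -> (forall x, 0 <= f x) -> \int[mu]_x f x = 0 ->
  aev (fun x => f x = 0).
Proof.
move=> lf f0 If; have mf := L1_meas lf.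
have mEf : measurable_fun [set: measurableTypeR R] (EFin \o f).
  exact/measurable_EFinP.
have [H _] := ae_eq_integral_abs mu measurableT mEf.
suff /H H0 : (\int[mu]_x `|(EFin \o f) x| = 0)%E.
  by apply: (ae_mono H0) => x /(_ I)/= [].
have -> : (\int[mu]_x `|(EFin \o f) x| = \int[mu]_x (f x)%:E)%E.
  by apply: eq_integral => x _ /=; rewrite ger0_norm.
move: If; rewrite /Rintegral => /= If; rewrite -[LHS]fineK ?If//.
by apply: integrable_fin_num.
Qed.

Lemma L1_itv (a b : R) b0 b1 :
  L1 (\1_[set` Interval (BSide b0 a) (BSide b1 b)]).
Proof. exact: integrable_indic_itv. Qed.

Lemma Rint_itv (a b : R) b0 b1 : a <= b ->
  \int[mu]_x (\1_[set` Interval (BSide b0 a) (BSide b1 b)] x) = b - a.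
Proof.
move=> ab; rewrite /Rintegral integral_indic//= setIT lebesgue_measure_itv/=.
case: ifPn => //; rewrite lte_fin -leNgt => ba.
by have -> : a = b by [apply/eqP; rewrite eq_le ab ba]; rewrite subrr.
Qed.

Lemma Rint_dominated_cvg (F : nat -> R -> R) f g : (forall n, measurable_fun setT (F n)) ->
  measurable_fun setT f -> L1 g ->
  (forall n, aev (fun x => `|F n x| <= g x)) ->
  (forall x, F ^~ x @ \oo --> f x) ->
  (fun n => \int[mu]_x F n x) @ \oo --> \int[mu]_x f x.
Proof.
move=> mF mf lg Fg Ff.
have lf : L1 f.
  apply: (L1_ae_dom mf lg).
  have := ae_foralln_imp Fg.
  move=> /ae_mono; apply => x Fx.
  by apply: (cvgr_to_le (cvg_norm (Ff x))); exact: nearW.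
have EF n : measurable_fun [set: measurableTypeR R] (EFin \o F n).
  have mFn := mF n; first [by apply/measurable_EFinP | by apply: measurableT_comp mFn|by move: mFn => /measurable_EFinP].
have Ef : measurable_fun [set: measurableTypeR R] (EFin \o f).
  exact/measurable_EFinP.
have cv : {ae mu, forall x, [set: measurableTypeR R] x ->
    (fun n => (EFin \o F n) x) @ \oo --> (EFin \o f) x}.
  apply: aeW => x _; apply: cvg_EFin; [exact: nearW|exact: Ff].
have bd : {ae mu, forall x n, [set: measurableTypeR R] x ->
    (`|(EFin \o F n) x| <= (EFin \o g) x)%E}.
  have /ae_mono := ae_foralln_imp Fg; apply => x Fx n _.
  by rewrite /= lee_fin.
have [_ _ H] := dominated_convergence measurableT EF Ef cv lg bd.
by apply: fine_cvg; rewrite fineK//; exact: integrable_fin_num.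
Qed.

Lemma L2_meas f : L2 f -> measurable_fun setT f. Proof. by case. Qed.

Lemma L2_mul f g : L2 f -> L2 g -> L1 (fun x => f x * g x).
Proof.
move=> [mf lf] [mg lg]; apply: (L1_dom _ (L1D lf lg)).
  exact: measurable_funM.
move=> x; rewrite ler_norml; nra.
Qed.

Lemma L2_dom f g : measurable_fun setT f -> L2 g ->
  aev (fun x => `|f x| <= `|g x|) -> L2 f.
Proof.
move=> mf [mg lg] fg; split => //; apply: (L1_ae_dom _ lg).
  exact: measurable_funX.
apply: (ae_mono fg) => x h.
by rewrite normrX -[leRHS]real_normK ?num_real// lerXn2r// ?nnegrE.
Qed.

Lemma L2Z (c : R) f : L2 f -> L2 (fun x => c * f x).
Proof.
move=> [mf lf]; split; first exact: measurable_funM.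
by under eq_fun do rewrite exprMn; exact: L1Z.
Qed.

Lemma L2D f g : L2 f -> L2 g -> L2 (fun x => f x + g x).
Proof.
move=> lf lg; split; first exact: measurable_funD lf.1 lg.1.
under eq_fun do rewrite sqrrD.
apply: L1D; last exact: lg.2.
apply: L1D; first exact: lf.2.
by under eq_fun do rewrite -mulr_natl; apply: L1Z; exact: L2_mul.
Qed.

Lemma L2B f g : L2 f -> L2 g -> L2 (fun x => f x - g x).
Proof.
move=> lf lg; under eq_fun do rewrite -mulN1r.
by apply: L2D lf _; exact: L2Z.
Qed.

Lemma L2_bdM (M : R) f g : measurable_fun setT f ->
  aev (fun x => `|f x| <= M) -> L2 g -> L2 (fun x => f x * g x).
Proof.
move=> mf fM lg; apply: (@L2_dom _ (fun x => M * g x)); last 2 first.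
- exact: L2Z.
- apply: (ae_mono fM) => x fxM; rewrite !normrM ler_wpM2r//.
  by rewrite (le_trans fxM)// ler_norm.
by apply: measurable_funM => //; exact: lg.1.
Qed.

Lemma L2_itv (a b : R) b0 b1 :
  L2 (\1_[set` Interval (BSide b0 a) (BSide b1 b)]).
Proof.
split; first exact: measurable_indic.
rewrite (_ : (fun _ => _) = \1_[set` Interval (BSide b0 a) (BSide b1 b)]).
  exact: L1_itv.
by apply/funext => x; rewrite indicE; case: (_ \in _); rewrite ?expr1n ?expr0n.
Qed.

(** The bridge to the space used in [W12], whose norm is written with real powers; its finiteness
    amounts to integrability of the square. *)
Lemma L2_Lfun f : L2 f <-> f \in Lfun mu 2%:E.
Proof.
split => [[mf lf]|lf].
  rewrite inE; apply/andP; split; rewrite inE//=.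
  rewrite /finite_norm unlock /Lnorm poweR_lty//.
  have /integrableP[_] := lf.
  suff -> : (\int[mu]_x `|(EFin \o f) x| `^ 2 =
    \int[mu]_x `|(EFin \o (fun x0 : R => (f x0 ^+ 2)%R)) x|)%E by [].
  by apply: eq_integral => x _; rewrite /= powR_mulrn// normrX.
have mf : measurable_fun setT f.
  by move: lf; rewrite inE => /andP[/set_mem].
by split => //; exact: Lfun2_integrable_sqr.
Qed.

End integrable_functions.

(** * Smooth functions and cutoffs *)

Section derivatives.
Context {R : realType}.
Implicit Types (f g : R -> R) (x y a b c : R).

Definition isD f x a := is_derive x 1 f a.

Lemma isD_eq f x a b : isD f x a -> a = b -> isD f x b.
Proof. by move=> + <-. Qed.

Lemma isDD f g x a b : isD f x a -> isD g x b ->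
  isD (fun y => f y + g y) x (a + b).
Proof. by move=> fa gb; exact: is_deriveD. Qed.

Lemma isDN f x a : isD f x a -> isD (fun y => - f y) x (- a).
Proof. by move=> fa; exact: is_deriveN. Qed.

Lemma isDB f g x a b : isD f x a -> isD g x b ->
  isD (fun y => f y - g y) x (a - b).
Proof. by move=> fa gb; exact: is_deriveB. Qed.

Lemma isDM f g x a b : isD f x a -> isD g x b ->
  isD (fun y => f y * g y) x (a * g x + f x * b).
Proof.
move=> fa gb; apply: (isD_eq (@is_deriveM _ _ f g x 1 a b fa gb)).
by rewrite /GRing.scale /= addrC mulrC.
Qed.

Lemma isDc c x : isD (fun=> c) x 0.
Proof. exact: is_derive_cst. Qed.

Lemma isDZ c f x a : isD f x a -> isD (fun y => c * f y) x (c * a).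
Proof.
by move=> fa; apply: isD_eq; [exact: isDM (isDc c x) fa|rewrite mul0r add0r].
Qed.

Lemma isDid x : isD (fun y => y) x 1.
Proof. exact: is_derive_id. Qed.

Lemma isDcomp f g x a b : isD f (g x) a -> isD g x b ->
  isD (fun y => f (g y)) x (a * b).
Proof.
by move=> fa gb; exact: (@is_derive1_comp _ f g x a b).
Qed.

Lemma isDX (n : nat) x : isD (fun y => y ^+ n) x (n%:R * x ^+ n.-1).
Proof.
elim: n => [|n IH]; first by rewrite mul0r; exact: isDc.
under eq_fun do rewrite exprS.
apply: isD_eq; first exact: isDM (isDid x) IH.
case: n {IH} => [|n] /=; first by rewrite mul0r mulr0 addr0.
by rewrite -[n.+2%:R]natr1 exprS; ring.
Qed.

Lemma isD_derive1 f f' : (forall x, isD f x (f' x)) -> derive1 f = f'.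
Proof. by move=> H; apply/funext => x; rewrite derive1E; have [_ ->] := H x. Qed.

Lemma derivable_isD f x : derivable f x 1 -> isD f x (derive1 f x).
Proof. by move=> df; split => //; rewrite derive1E. Qed.

Lemma isD_cont f x a : isD f x a -> {for x, continuous f}.
Proof.
by move=> [df _]; apply: differentiable_continuous; exact/derivable1_diffP.
Qed.

Lemma isD_near f g x a : (\forall y \near x, f y = g y) -> isD f x a -> isD g x a.
Proof.
move=> fg [df fa]; split; last by rewrite -fa; apply/esym/near_eq_derive.
by apply: near_eq_derivable df.
Qed.

Lemma MVT_isD f f' x y : (forall z, isD f z (f' z)) -> x <= y ->
  exists2 c, x <= c <= y & f y - f x = f' c * (y - x).
Proof.
move=> df xy; have cf : {within `[x, y], continuous f}.
  by apply: continuous_subspaceT => z; exact: isD_cont (df z).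
have [c] := MVT_segment xy (fun z _ => df z) cf.
by rewrite in_itv/= => xcy fyx; exists c.
Qed.

Lemma isD_ndecr f f' x y : (forall z, isD f z (f' z)) ->
  (forall z, 0 <= f' z) -> x <= y -> f x <= f y.
Proof.
move=> df f0 xy; have [c _ fyx] := MVT_isD df xy.
by rewrite -subr_ge0 fyx mulr_ge0// subr_ge0.
Qed.

(** The hypothesis is a closed condition on the values of [f], so it survives pointwise limits. It
    also settles the derivative of [flat] at the origin. *)
Lemma isD_quadratic f x a (C : R) :
  (forall h, `|f (x + h) - f x - h * a| <= C * h ^+ 2) -> isD f x a.
Proof.
move=> fC; have C0 : 0 <= C.
  by have := fC 1; rewrite expr1n mulr1; apply: le_trans.
suff cv : h^-1 *: (f (h *: (1 : R) + x) - f x) @[h --> (0 : R)^'] --> a.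
  by split; [apply/cvg_ex; exists a|exact/cvg_lim].
apply/cvgrPdist_le => e e0.
have C1 : 0 < C + 1 by rewrite ltr_wpDl.
near=> h; have h0 : h != 0 by near: h; exact: nbhs_dnbhs_neq.
have hC : `|h| < e / (C + 1).
  by near: h; apply: dnbhs0_lt; rewrite divr_gt0.
rewrite /GRing.scale /= mulr1 (addrC h).
have -> : a - h^-1 * (f (x + h) - f x) =
    - h^-1 * (f (x + h) - f x - h * a) by field.
rewrite normrM normrN normfV mulrC ler_pdivrMr ?normr_gt0//.
rewrite (le_trans (fC h))// -real_normK ?num_real// expr2 mulrA.
rewrite ler_wpM2r// (@le_trans _ _ ((C + 1) * `|h|))//.
  by rewrite ler_wpM2r// lerDl.
by move/ltW: hC; rewrite ler_pdivlMr// mulrC.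
Unshelve. all: by end_near. Qed.

(** The recursion on the derivative lets the product rule yield closure under products by induction,
    without a formula for iterated derivatives; [smoothP] is the link with [derive1n]. *)
Fixpoint Cn (n : nat) f : Prop :=
  if n is m.+1 then (forall x, derivable f x 1) /\ Cn m (derive1 f) else True.

Definition smooth f := forall n, Cn n f.

Lemma CnS_isD n f f' : (forall x, isD f x (f' x)) -> Cn n f' -> Cn n.+1 f.
Proof.
by move=> df cf; split=> [x|]; [have [] := df x|rewrite (isD_derive1 df)].
Qed.

Lemma CnS_le n f : Cn n.+1 f -> Cn n f.
Proof. by elim: n f => // n IH f [df cf]; split => //; exact: IH. Qed.

Lemma Cn_cst n c : Cn n (fun=> c).
Proof.
by elim: n c => // n IH c; apply: CnS_isD (IH 0) => x; exact: isDc.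
Qed.

Lemma CnD n f g : Cn n f -> Cn n g -> Cn n (fun x => f x + g x).
Proof.
elim: n f g => // n IH f g [df cf] [dg cg].
apply: CnS_isD (IH _ _ cf cg) => x.
by apply: isDD; exact: derivable_isD.
Qed.

Lemma CnM n f g : Cn n f -> Cn n g -> Cn n (fun x => f x * g x).
Proof.
elim: n f g => // n IH f g F G; have [df cf] := F; have [dg cg] := G.
apply: (@CnS_isD _ _ (fun x => derive1 f x * g x + f x * derive1 g x)).
  by move=> x; apply: isDM; exact: derivable_isD.
by apply: CnD; apply: IH => //; exact: CnS_le.
Qed.

Lemma CnZ n c f : Cn n f -> Cn n (fun x => c * f x).
Proof. by apply: CnM; exact: Cn_cst. Qed.

Lemma CnB n f g : Cn n f -> Cn n g -> Cn n (fun x => f x - g x).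
Proof.
move=> cf cg; have := CnD cf (CnZ (-1) cg).
by under eq_fun do rewrite mulN1r.
Qed.

Lemma Cn_affine n f (k d : R) : Cn n f -> Cn n (fun x => f (k * (x - d))).
Proof.
elim: n f => // n IH f [df cf].
apply: (@CnS_isD _ _ (fun x => derive1 f (k * (x - d)) * k)); last first.
  by apply: CnM; [exact: IH|exact: Cn_cst].
move=> x; apply: isDcomp; first exact: derivable_isD.
apply: isD_eq; first by apply: isDZ; apply: isDB; [exact: isDid|exact: isDc].
by rewrite subr0 mulr1.
Qed.

Lemma smoothP f : smooth f <-> forall n x, derivable (derive1n n f) x 1.
Proof.
split=> [sf n|].
  have := sf n.+1; elim: n f {sf} => [|n IH] f; first by case.
  by move=> [df cf] x; rewrite derive1Sn; exact: IH.
move=> df n; elim: n f df => // n IH f df; split; first exact: (df 0%N).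
by apply: IH => m x; rewrite -derive1Sn; exact: df.
Qed.

Lemma smooth_derive1 f : smooth f -> smooth (derive1 f).
Proof. by move=> sf n; have [] := sf n.+1. Qed.

Lemma smooth_isD f x : smooth f -> isD f x (derive1 f x).
Proof. by move=> sf; apply: derivable_isD; have [] := sf 1%N. Qed.

Lemma smooth_cont f : smooth f -> continuous f.
Proof. by move=> sf x; exact: isD_cont (smooth_isD x sf). Qed.

End derivatives.

(** * A smooth transition from 0 to 1, and smooth cutoffs *)

Section smooth_step.
Context {R : realType}.
Local Notation mu := (@lebesgue_measure R).
Implicit Types (x y a b k : R).

(* The span of this family is stable under differentiation. *)
Definition flat (m : nat) x : R :=
  if 0 < x then x^-1 ^+ m * expR (- x^-1) else 0.

Lemma flat_ge0 m x : 0 <= flat m x.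
Proof.
by rewrite /flat; case: ifPn => // x0; rewrite mulr_ge0 ?expR_ge0// exprn_ge0// invr_ge0 ltW.
Qed.

(** For $x>0$ put $y=1/x$ and use $e^y\ge y^{m+2}/(m+2)!$. The square on the right is what
    [isD_quadratic] needs to give the derivative 0 at the origin. *)
Lemma flat_le m x : flat m x <= (m.+2)`!%:R * x ^+ 2.
Proof.
rewrite /flat; case: ifPn => x0; last by rewrite mulr_ge0 ?sqr_ge0.
have y0 : 0 < x^-1 by rewrite invr_gt0.
have F0 : 0 < (m.+2)`!%:R :> R by rewrite ltr0n fact_gt0.
have := expR_ge1Dxn m.+1 (ltW y0); set y := x^-1 in y0 *.
have -> : x = y^-1 by rewrite invrK.
clearbody y.
rewrite expRN => ey.
have {ey} : y ^+ m.+2 / (m.+2)`!%:R <= expR y by lra.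
rewrite ler_pdivrMr// => ey.
rewrite exprVn ler_pdivrMr ?expR_gt0// mulrAC ler_pdivlMr ?exprn_gt0//.
by rewrite -exprD addn2 mulrC.
Qed.

Lemma isD_flat m x : isD (flat m) x (- m%:R * flat m.+1 x + flat m.+2 x).
Proof.
have [x0|x0|->] := ltgtP x 0.
- apply: (@isD_near _ (fun=> 0)).
    by near=> y; rewrite /flat ltNge ltW//=; near: y; exact: lt_nbhsl.
  apply: isD_eq; first exact: isDc.
  by rewrite /flat ltNge (ltW x0)/= mulr0 addr0.
- apply: (@isD_near _ (fun y => y^-1 ^+ m * expR (- y^-1))).
    by near=> y; rewrite /flat ifT//; near: y; exact: lt_nbhsr.
  have dV : isD (fun y : R => y^-1) x (- x ^- 2).
    apply: isD_eq; first apply: is_deriveV; first by rewrite gt_eqF.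
    by rewrite /GRing.scale/= mulr1.
  apply: isD_eq.
    apply: isDM.
      by apply: (@isDcomp _ (fun z => z ^+ m)); [exact: isDX|exact: dV].
    by apply: (@isDcomp _ expR); [exact: is_derive_expR|exact: isDN dV].
  rewrite /flat x0 /GRing.scale/= -!exprVn; set y := x^-1.
  case: m => [|m]; first by rewrite !expr0; ring.
  by rewrite /= !exprS -natr1; ring.
- apply: (@isD_quadratic _ _ _ _ (m.+2)`!%:R) => h.
  by rewrite add0r {2 3 4}/flat ltxx mulr0 addr0 mulr0 !subr0 ger0_norm ?flat_ge0// flat_le.
Unshelve. all: by end_near. Qed.

Lemma Cn_flat n m : Cn n (flat m).
Proof.
elim: n m => // n IH m; apply: CnS_isD (fun x => isD_flat m x) _.
by apply: CnD; [exact: CnZ|exact: IH].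
Qed.

Definition bump x : R := flat 0 x * flat 0 (1 - x).

Lemma smooth_bump : smooth bump.
Proof.
move=> n; apply: CnM; first exact: Cn_flat.
have := @Cn_affine _ n _ (-1) 1 (Cn_flat n 0).
by under eq_fun do rewrite mulN1r opprB.
Qed.

Lemma bump_ge0 x : 0 <= bump x.
Proof. by rewrite mulr_ge0 ?flat_ge0. Qed.

Lemma bump_le1 x : bump x <= 1.
Proof.
have H y : flat 0 y <= 1.
  rewrite /flat; case: ifPn => // y0.
  by rewrite mul1r -expR0 ler_expR oppr_le0 invr_ge0 ltW.
by rewrite mulr_ile1 ?flat_ge0.
Qed.

Lemma bump_out x : (x <= 0) || (1 <= x) -> bump x = 0.
Proof.
rewrite /bump /flat; case/orP => x0.
  by rewrite ltNge x0/= mul0r.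
by rewrite subr_gt0 (ltNge x 1) x0/= mulr0.
Qed.

Lemma bump_half_gt0 : 0 < bump 2^-1.
Proof.
rewrite /bump /flat invr_gt0 ltr0n/=.
have -> : 1 - 2^-1 = 2^-1 :> R by field.
by rewrite invr_gt0 ltr0n/= mulr_gt0// mulr_gt0 ?expR_gt0.
Qed.

Lemma continuous_meas (f : R -> R) : continuous f -> measurable_fun setT f.
Proof. exact: continuous_measurable_fun. Qed.

Lemma smooth_meas (f : R -> R) : smooth f -> measurable_fun setT f.
Proof. by move=> /smooth_cont/continuous_meas. Qed.

Lemma L1_bump : L1 bump.
Proof.
apply: (L1_dom _ (L1_itv 0 1 true false)).
  exact: smooth_meas smooth_bump.
move=> x; rewrite indicE ger0_norm ?bump_ge0//.
have [x01|x01] := boolP (x \in _); first exact: bump_le1.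
rewrite bump_out//; move: x01; rewrite notin_setE/= in_itv/= => /negP.
by rewrite negb_and -!ltNge => /orP[] /ltW ->; rewrite ?orbT.
Qed.

Definition bump_int x : R := \int[mu]_(t in `]-oo, x]) bump t.

Lemma isD_bump_int x : isD bump_int x (bump x).
Proof.
have xx1 : x < x + 1 by rewrite ltrDl.
have ib : mu.-integrable `]-oo, x + 1] (EFin \o bump).
  by apply: integrableS L1_bump.
have cb : {for x, continuous bump} by exact/smooth_cont/smooth_bump.
have [d1 d2] := continuous_FTC1 xx1 ib (ltNyr x) cb.
split; first exact: d1.
by rewrite -derive1E; exact: d2.
Qed.

Definition bump_mass : R := bump_int 1 - bump_int 0.

(** Otherwise the nondecreasing [bump_int] would be constant on $[0,1]$, and its derivative at $1/2$
    would be 0 instead of the positive [bump 2^-1]. *)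
Lemma bump_mass_gt0 : 0 < bump_mass.
Proof.
have nd := isD_ndecr isD_bump_int bump_ge0.
rewrite lt_neqAle subr_ge0 nd ?andbT//; apply/eqP => m0.
have c01 y : 0 <= y <= 1 -> bump_int y = bump_int 0.
  move=> /andP[y0 y1]; apply/eqP; rewrite eq_le (nd _ _ y0) andbT.
  by move: m0 => /esym/eqP; rewrite subr_eq0 => /eqP <-; exact: nd.
have := isD_bump_int 2^-1.
have : isD bump_int 2^-1 0.
  apply: (@isD_near _ (fun=> bump_int 0)); last exact: isDc.
  near=> y; apply/esym/c01/andP; split; apply: ltW; near: y.
    by apply: lt_nbhsr; rewrite invr_gt0.
  by apply: lt_nbhsl; rewrite invf_lt1// ltr1n.
move=> [_ e0] [_ e]; move: bump_half_gt0; rewrite -e e0 ltxx.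
Unshelve. all: by end_near. Qed.

Definition step x : R := (bump_int x - bump_int 0) / bump_mass.
Definition dstep x : R := bump x / bump_mass.

Lemma isD_step x : isD step x (dstep x).
Proof.
rewrite /step /dstep; under eq_fun do rewrite mulrC.
apply: isD_eq.
  by apply: isDZ; apply: isDB; [exact: isD_bump_int|exact: isDc].
by rewrite subr0 mulrC.
Qed.

Lemma smooth_dstep : smooth dstep.
Proof.
move=> n; rewrite /dstep; under eq_fun do rewrite mulrC.
by apply: CnZ; exact: smooth_bump.
Qed.

Lemma smooth_step : smooth step.
Proof.
by case=> // n; apply: (CnS_isD isD_step); exact: smooth_dstep.
Qed.

Lemma dstep_ge0 x : 0 <= dstep x.
Proof. by rewrite divr_ge0 ?bump_ge0// ltW// bump_mass_gt0. Qed.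

Lemma dstep_le x : dstep x <= bump_mass^-1.
Proof. by rewrite ler_piMl ?bump_le1// invr_ge0 ltW// bump_mass_gt0. Qed.

Lemma dstep_out x : (x <= 0) || (1 <= x) -> dstep x = 0.
Proof. by move=> /bump_out; rewrite /dstep => ->; rewrite mul0r. Qed.

Lemma step_ndecr x y : x <= y -> step x <= step y.
Proof. exact: isD_ndecr isD_step dstep_ge0. Qed.

Lemma step0 x : x <= 0 -> step x = 0.
Proof.
move=> x0; have [c /andP[_ c0]] := MVT_isD isD_step x0.
have -> : step 0 = 0 by rewrite /step subrr mul0r.
by rewrite dstep_out ?c0// mul0r sub0r => /eqP; rewrite oppr_eq0 => /eqP.
Qed.

Lemma step1 x : 1 <= x -> step x = 1.
Proof.
move=> x1; have [c /andP[c1 _]] := MVT_isD isD_step x1.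
have -> : step 1 = 1 by rewrite /step divff// gt_eqF// bump_mass_gt0.
by rewrite dstep_out ?c1 ?orbT// mul0r => /eqP; rewrite subr_eq0 => /eqP.
Qed.

Lemma step_ge0 x : 0 <= step x.
Proof.
have [x0|x0] := leP x 0; first by rewrite step0.
by rewrite -(@step0 0)// step_ndecr// ltW.
Qed.

Lemma step_le1 x : step x <= 1.
Proof.
have [x0|x0] := leP 1 x; first by rewrite step1.
by rewrite -(@step1 1)// step_ndecr// ltW.
Qed.

(** A smooth approximation of the indicator of $]a,b]$ for large $k$. Both transitions lie to the
    right of their end points, on $[a,a+1/k]$ and $[b,b+1/k]$, so the derivative is a difference of
    two translates of one kernel. *)
Definition cutoff k a b x : R := step (k * (x - a)) - step (k * (x - b)).
Definition dcutoff k a b x : R :=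
  k * dstep (k * (x - a)) - k * dstep (k * (x - b)).

Lemma isD_cutoff k a b x : isD (cutoff k a b) x (dcutoff k a b x).
Proof.
have H d : isD (fun x => step (k * (x - d))) x (k * dstep (k * (x - d))).
  apply: isD_eq; first apply: (isDcomp (g := fun x => k * (x - d))).
  - exact: isD_step.
  - by apply: isDZ; apply: isDB; [exact: isDid|exact: isDc].
  - by rewrite subr0 mulr1 mulrC.
exact: isDB.
Qed.

Lemma smooth_cutoff k a b : smooth (cutoff k a b).
Proof. by move=> n; apply: CnB; apply: Cn_affine; exact: smooth_step. Qed.

Lemma cutoff_ge0 k a b x : 0 < k -> a <= b -> 0 <= cutoff k a b x.
Proof.
by move=> k0 ab; rewrite subr_ge0 step_ndecr// ler_pM2l// lerB.
Qed.

Lemma cutoff_le1 k a b x : cutoff k a b x <= 1.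
Proof. by rewrite lerBlDr (le_trans (step_le1 _))// lerDl step_ge0. Qed.

Lemma cutoff_out k a b x : 0 < k -> a <= b -> (x <= a) || (b + k^-1 <= x) ->
  cutoff k a b x = 0.
Proof.
move=> k0 ab /orP[xa|bx]; rewrite /cutoff.
  by rewrite !step0 ?subrr// pmulr_rle0// subr_le0// (le_trans xa).
rewrite !step1 ?subrr//.
  by rewrite -ler_pdivrMl// mulr1 lerBrDl.
rewrite -ler_pdivrMl// mulr1 lerBrDl (le_trans _ bx)// lerD2r//.
Qed.

Lemma support_test (f : R -> R) a b : smooth f ->
  (forall x, (x <= a) || (b <= x) -> f x = 0) -> test_function f.
Proof.
move=> sf f0; split; first exact/smoothP.
apply: (@subclosed_compact _ _ `[a, b]).
- exact: closed_closure.
- exact: segment_compact.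
- rewrite ((closure_id `[a, b]).1 (@interval_closed _ (BLeft a) (BRight b) isT isT)).
  apply: closure_subset => x /= fx; rewrite in_itv/=.
  apply: contra_neqT fx; rewrite negb_and -!ltNge => H.
  by apply: f0; case/orP: H => /ltW ->; rewrite ?orbT.
Qed.

Lemma test_cutoff k a b : 0 < k -> a <= b -> test_function (cutoff k a b).
Proof.
move=> k0 ab; apply: (@support_test _ a (b + k^-1)); first exact: smooth_cutoff.
by move=> x; exact: cutoff_out.
Qed.

End smooth_step.

(** * Oriented integrals *)

Section oriented_integral.
Context {R : realType}.
Local Notation mu := (@lebesgue_measure R).
Implicit Types (f g u : R -> R) (x y a b c : R).

Lemma isD_eps f x a : (forall e, 0 < e -> exists2 d, 0 < d &
    forall h, `|h| < d -> `|f (x + h) - f x - h * a| <= e * `|h|) -> isD f x a.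
Proof.
move=> fe.
suff cv : h^-1 *: (f (h *: (1 : R) + x) - f x) @[h --> (0 : R)^'] --> a.
  by split; [apply/cvg_ex; exists a|exact/cvg_lim].
apply/cvgrPdist_le => e e0; have [d d0 fd] := fe e e0.
near=> h; have h0 : h != 0 by near: h; exact: nbhs_dnbhs_neq.
have hd : `|h| < d by near: h; exact: dnbhs0_lt.
rewrite /GRing.scale /= mulr1 (addrC h).
have -> : a - h^-1 * (f (x + h) - f x) =
    - h^-1 * (f (x + h) - f x - h * a) by field.
by rewrite normrM normrN normfV mulrC ler_pdivrMr ?normr_gt0// fd.
Unshelve. all: by end_near. Qed.

(* The oriented indicator: 1 on ]a, b] if a <= b, and -1 on ]b, a] otherwise. *)
Definition chi a b x : R := (x <= b)%R%:R - (x <= a)%R%:R.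

Lemma chiE a b : a <= b -> chi a b = \1_`]a, b].
Proof.
move=> ab; apply/funext => x; rewrite /chi indicE mem_setE in_itv/=.
have [xa|ax] := leP x a; last by rewrite subr0.
by rewrite (le_trans xa ab) subrr.
Qed.

Lemma chiN a b x : chi a b x = - chi b a x.
Proof. by rewrite /chi opprB. Qed.

Lemma chi_chasles a b c x : chi a b x + chi b c x = chi a c x.
Proof. by rewrite /chi; ring. Qed.

Lemma chi_norm_le1 a b x : `|chi a b x| <= 1.
Proof.
by rewrite /chi; case: (x <= a); case: (x <= b);
  rewrite ?subrr ?subr0 ?sub0r ?normrN ?normr1 ?normr0.
Qed.

Lemma L2_chi a b : L2 (chi a b).
Proof.
have [ab|/ltW ab] := leP a b; first by rewrite chiE//; exact: L2_itv.
have -> : chi a b = (fun x => - 1 * chi b a x).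
  by apply/funext => x; rewrite mulN1r -chiN.
by apply: L2Z; rewrite chiE//; exact: L2_itv.
Qed.

Lemma L1_chi a b : L1 (chi a b).
Proof.
have [ab|/ltW ab] := leP a b; first by rewrite chiE//; exact: L1_itv.
have -> : chi a b = (fun x => - 1 * chi b a x).
  by apply/funext => x; rewrite mulN1r -chiN.
by apply: L1Z; rewrite chiE//; exact: L1_itv.
Qed.

Lemma Rint_chi a b : \int[mu]_x chi a b x = b - a.
Proof.
have [ab|/ltW ab] := leP a b; first by rewrite chiE// Rint_itv.
under eq_Rintegral do rewrite chiN.
by rewrite Rint_opp ?chiE ?Rint_itv ?opprB//; exact: L1_itv.
Qed.

Lemma Rint_norm_chi a b : \int[mu]_x `|chi a b x| = `|b - a|.
Proof.
wlog ab : a b / a <= b.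
  move=> H; have [/H//|/ltW/H] := leP a b.
  by rewrite distrC => <-; apply: eq_Rintegral => x _; rewrite chiN normrN.
rewrite -Rint_chi ger0_norm ?Rint_chi ?subr_ge0// -Rint_chi.
by apply: eq_Rintegral => x _; rewrite chiE// ger0_norm.
Qed.

(** Local integrability stated through [chi], so that [oint] is meaningful for end points in either
    order. *)
Definition loc g := measurable_fun setT g /\ forall a b, L1 (fun x => g x * chi a b x).

Lemma L2_loc g : L2 g -> loc g.
Proof.
by move=> lg; split=> [|a b]; [exact: L2_meas|apply: L2_mul => //; exact: L2_chi].
Qed.

Lemma loc_cst c : loc (fun=> c).
Proof. by split => // a b; apply: L1Z; exact: L1_chi. Qed.

Lemma locB f g : loc f -> loc g -> loc (fun x => f x - g x).
Proof.
move=> [mf lf] [mg lg]; split; first exact: measurable_funB.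
by move=> a b; under eq_fun do rewrite mulrBl; exact: L1B.
Qed.

Lemma L1_loc g : L1 g -> loc g.
Proof.
move=> lg; have mg := L1_meas lg; split => // a b.
apply: (L1_dom _ (L1_norm lg)).
  by apply: measurable_funM => //; exact: L1_meas (L1_chi a b).
by move=> x; rewrite normrM ler_piMr// chi_norm_le1.
Qed.

Lemma loc_norm g : loc g -> loc (fun x => `|g x|).
Proof.
move=> [mg lg]; split; first exact: measurableT_comp.
move=> a b; apply: (L1_dom _ (L1_norm (lg a b))).
  apply: measurable_funM; first exact: measurableT_comp.
  exact: L1_meas (L1_chi a b).
by move=> x; rewrite !normrM normr_id.
Qed.

Lemma loc_continuous g : continuous g -> loc g.
Proof.
move=> cg; have mg := continuous_meas cg; split => // a b.
wlog ab : a b / a <= b.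
  move=> H; have [/H//|/ltW/H] := leP a b.
  move=> /L1N; congr L1; apply/funext => x.
  by rewrite (chiN a b) mulrN.
have sc : compact `[a, b]%classic by exact: segment_compact.
have : mu.-integrable `[a, b] (EFin \o g).
  by apply: continuous_compact_integrable => //; exact: continuous_subspaceT.
move=> /(integrable_mkcond _ _).1 => /(_ (measurable_itv _)) ig.
have lg : L1 (g \_ `[a, b]) by rewrite /L1 -restrict_EFin.
apply: (L1_dom _ (L1_norm lg)).
  by apply: measurable_funM => //; exact: L1_meas (L1_chi a b).
move=> x; rewrite chiE// indicE patchE !mem_setE !in_itv/=.
have [xa|ax] := leP x a; first by rewrite mulr0 normr0.
by rewrite (ltW ax)/=; case: (x <= b); rewrite ?mulr1// mulr0 normr0.
Qed.

(** Written as one integral over the line, it satisfies the Chasles relation by linearity, with no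
    case distinction on the order of the end points. *)
Definition oint g a b : R := \int[mu]_x (g x * chi a b x).

Lemma oint_chasles g a b c : loc g -> oint g a b + oint g b c = oint g a c.
Proof.
move=> [_ lg]; rewrite /oint -Rint_add//; apply: eq_Rintegral => x _.
by rewrite -mulrDr chi_chasles.
Qed.

Lemma ointN g a b : loc g -> oint g a b = - oint g b a.
Proof.
move=> [_ lg]; rewrite /oint -Rint_opp//; apply: eq_Rintegral => x _.
by rewrite chiN mulrN.
Qed.

Lemma oint_cst c a b : oint (fun=> c) a b = c * (b - a).
Proof. by rewrite /oint Rint_scale ?Rint_chi//; exact: L1_chi. Qed.

Lemma ointB f g a b : loc f -> loc g ->
  oint (fun x => f x - g x) a b = oint f a b - oint g a b.
Proof.
move=> [_ lf] [_ lg]; rewrite /oint -Rint_sub//; apply: eq_Rintegral => x _.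
by rewrite mulrBl.
Qed.

Lemma chi_neq0 a b x : chi a b x != 0 -> `|x - a| <= `|b - a|.
Proof.
rewrite /chi; have [xb|bx] := leP x b; have [xa|ax] := leP x a;
  rewrite ?subrr ?eqxx// => _.
- by rewrite !ger0_norm; lra.
- by rewrite !ler0_norm; lra.
Qed.

Lemma oint_bound g a b (M : R) : loc g ->
  aev (fun x => `|x - a| <= `|b - a| -> `|g x| <= M) ->
  `|oint g a b| <= M * `|b - a|.
Proof.
move=> [_ lg] gM.
rewrite -Rint_norm_chi -Rint_scale; last exact: L1_norm (L1_chi a b).
apply: Rint_norm_le => //; first by apply: L1Z; exact: L1_norm (L1_chi a b).
apply: (ae_mono gM) => x gMx; rewrite normrM.
have [->|/chi_neq0/gMx] := eqVneq (chi a b x) 0; first by rewrite normr0 !mulr0.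
exact: ler_wpM2r.
Qed.

(** The values of the integral near [x] see [g] only up to a null set. This is how an equation that
    holds almost everywhere becomes a classical one. *)
Lemma isD_oint g G a x : loc g -> aev (fun y => g y = G y) ->
  {for x, continuous G} -> isD (oint g a) x (G x).
Proof.
move=> lg gG cG; apply: isD_eps => e e0.
have /cvgrPdist_le /(_ e e0) := cG; move=> /nbhs_ballP[d /= d0 Gd].
exists d => // h hd.
have -> : oint g a (x + h) - oint g a x = oint g x (x + h).
  by rewrite -(oint_chasles a x (x + h) lg); ring.
have -> : h * G x = oint (fun=> G x) x (x + h) by rewrite oint_cst; ring.
rewrite -ointB//; last exact: loc_cst.
have {2}-> : h = x + h - x by ring.
apply: oint_bound; first by apply: locB => //; exact: loc_cst.
apply: (ae_mono gG) => y ->; rewrite addrAC subrr add0r => yxh.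
rewrite distrC; apply: Gd; rewrite /ball/= distrC.
exact: le_lt_trans yxh hd.
Qed.

Lemma oint_FTC F f a b : (forall x, isD F x (f x)) -> continuous f ->
  oint f a b = F b - F a.
Proof.
move=> dF cf.
have H c : isD (fun x => oint f a x - F x) c 0.
  rewrite -(subrr (f c)); apply: isDB; last exact: dF.
  by apply: isD_oint => //; [exact: loc_continuous|exact: ae_all|exact: cf].
have K x y : x <= y -> oint f a x - F x = oint f a y - F y.
  move=> xy; have [c _] := MVT_isD H xy.
  by rewrite mul0r => /eqP; rewrite subr_eq0 => /eqP.
have : oint f a b - F b = oint f a a - F a by case: (leP a b) => [|/ltW] /K.
have -> : oint f a a = 0.
  have := oint_chasles a a a (loc_continuous cf); move=> h.
  by apply: (addrI (oint f a a)); rewrite h addr0.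
by move=> h; rewrite -[LHS](subrK (F b)) h; ring.
Qed.

(** Cauchy-Schwarz, by expanding $\int(g-c\chi)^2\ge 0$ with $c$ the oriented integral divided by
    $|b-a|$; note that $\int\chi^2=|b-a|$. *)
Lemma oint_sqr g a b : L2 g ->
  oint g a b ^+ 2 <= `|b - a| * \int[mu]_x (g x ^+ 2).
Proof.
move=> lg; have [->|ab] := eqVneq a b.
  have lc := L2_loc lg.
  suff -> : oint g b b = 0 by rewrite subrr normr0 mul0r expr0n.
  by apply: (addrI (oint g b b)); rewrite oint_chasles// addr0.
have d0 : 0 < `|b - a| by rewrite normr_gt0 subr_eq0 eq_sym.
pose c := oint g a b / `|b - a|.
have L : L1 (fun x => (g x - c * chi a b x) ^+ 2).
  by apply: (L2B lg _).2; apply: L2Z; exact: L2_chi.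
have := Rint_ge0 (fun x => sqr_ge0 (g x - c * chi a b x)).
have -> : \int[mu]_x ((g x - c * chi a b x) ^+ 2) =
   \int[mu]_x (g x ^+ 2) - (2 * c) * oint g a b + c ^+ 2 * `|b - a|.
  rewrite -Rint_norm_chi /oint -!Rint_scale; last 2 first.
  - exact: L1_norm (L1_chi a b).
  - exact: (L2_loc lg).2.
  have l1 : L1 (fun x => (2 * c) * (g x * chi a b x)).
    by apply: L1Z; exact: (L2_loc lg).2.
  have l2 : L1 (fun x => c ^+ 2 * `|chi a b x|).
    by apply: L1Z; exact: L1_norm (L1_chi a b).
  rewrite -Rint_sub//; last exact: lg.2.
  rewrite -Rint_add//; last by apply: L1B => //; exact: lg.2.
  apply: eq_Rintegral => x _.
  have -> : `|chi a b x| = chi a b x ^+ 2.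
    rewrite /chi; case: (x <= a); case: (x <= b);
     by rewrite ?subrr ?subr0 ?sub0r ?normrN ?normr1 ?normr0 ?sqrrN ?expr1n ?expr0n.
  by ring.
have -> : oint g a b = c * `|b - a| by rewrite /c divfK// gt_eqF.
set d := `|b - a| in d0 *; move=> h; nra.
Qed.

End oriented_integral.

(** * Weak derivatives *)

Section weak_derivatives.
Context {R : realType}.
Local Notation mu := (@lebesgue_measure R).
Implicit Types (f g u : R -> R) (x y a b c k : R).

(** * Lebesgue points and mollification *)

Lemma meas_patch f (D : set R) : measurable D -> measurable_fun setT f ->
  measurable_fun setT (f \_ D).
Proof.
move=> mD mf; have [H _] := measurable_restrictT f mD; apply: H.
exact: (measurable_funS measurableT (@subsetT _ D) mf).
Qed.

(** Puts [loc] in the form required by the Lebesgue differentiation theorem: a compact set lies in a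
    bounded interval. *)
Lemma loc_locally_integrable u : loc u -> locally_integrable setT u.
Proof.
move=> lu; split; [exact: lu.1|exact: openT|move=> K _ cK].
have /compact_bounded[M [_ /(_ (`|M| + 1))KM]] := cK.
have {}KM x : K x -> `|x| <= `|M| + 1.
  by move=> Kx; apply: KM => //; rewrite ltr_pwDr// ler_norm.
set N : R := `|M| + 1 in KM.
(* [chi] excludes its left end point, hence the margin 1 on the left. *)
have /integrableP[_] := L1_norm (lu.2 (- N - 1) N).
apply: le_lt_trans; rewrite integral_mkcond.
have -> : (fun x => `|u x|%:E) \_ K = EFin \o ((fun x => `|u x|) \_ K).
  by rewrite -restrict_EFin.
have mK := compact_measurable cK.
apply: ge0_le_integral => //.
- by move=> x _; rewrite /= lee_fin patchE; case: ifPn.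
- apply/measurable_EFinP; apply: meas_patch => //.
  by apply: measurableT_comp => //; exact: lu.1.
- apply: measurableT_comp => //; apply/measurable_EFinP.
  exact: L1_meas (L1_norm (lu.2 _ _)).
- move=> x _; rewrite /= lee_fin patchE; case: ifPn => [xK|_]; last exact: normr_ge0.
  have xN := KM _ (set_mem xK).
  rewrite normr_id normrM (_ : chi _ _ x = 1) ?normr1 ?mulr1//.
  move: xN; rewrite ler_norml /chi => /andP[Nx ->].
  by rewrite leNgt (_ : _ < x) ?subr0//; lra.
Qed.

Lemma ae_lebesgue_pt u : loc u -> aev (lebesgue_pt u).
Proof. by move=> /loc_locally_integrable/lebesgue_differentiation. Qed.

(** Averages over balls are turned into one-sided averages: $]a,a+r]$ lies in the open ball of
    radius $2r$, whose measure is $4r$, whence [e / 4] in the proof. *)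
Lemma lebesgue_pt_le u a e : loc u -> lebesgue_pt u a -> 0 < e ->
  exists2 d, 0 < d & forall r, 0 < r < d ->
    \int[mu]_x (`|u x - u a| * `|chi a (a + r) x|) <= e * r.
Proof.
move=> lu ua e0.
have e40 : 0 < e / 4 by rewrite divr_gt0.
have : \forall r \near (0 : R)^'+, (davg u a r < (e / 4)%:E)%E.
  have ua' A : nbhs 0%E A -> \forall r \near (0 : R)^'+, A (davg u a r).
    by move=> nA; exact: ua nA.
  apply: (ua' [set y | (y < (e / 4)%:E)%E]).
  apply: open_nbhs_nbhs; split; last by rewrite /= lte_fin.
  exact: open_ereal_lt_ereal.
move=> [d /= d0 dP]; exists (d / 2); first by rewrite divr_gt0.
move=> r /andP[r0 rd].
have r20 : 0 < r *+ 2 by rewrite mulrn_wgt0.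
have := dP (r *+ 2); rewrite /ball/= sub0r normrN gtr0_norm//.
have {3}-> : r *+ 2 = 2 * r by rewrite mulr_natl.
have r2d : r *+ 2 < d by rewrite -mulr_natl; lra.
move=> /(_ r2d r20)/ltW; rewrite /davg /iavg.
have r2 : 0 < 2 * r by rewrite mulr_gt0.
rewrite lebesgue_measure_ball ?(ltW r2)// inver mulrn_eq0/= (gt_eqF r2).
rewrite lee_pdivrMl; last by rewrite mulrn_wgt0.
set X := (\int[_]_(_ in _) _)%E => H.
rewrite -EFinM in H.
have -> : e * r = (2 * r) *+ 2 * (e / 4) by field.
have X0 : (0 <= X)%E by exact: integral_ge0.
have Xf : X \is a fin_num.
  by rewrite ge0_fin_numE// (le_lt_trans H)// ltry.
rewrite -(fineK Xf) lee_fin in H; apply: le_trans H.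
pose B := ball a (2 * r).
have -> : fine X = \int[mu]_x ((fun x => `|u x - u a|) \_ B) x.
  by rewrite -Rintegral_mkcond.
have lv : loc (fun x => u x - u a) by apply: locB => //; exact: loc_cst.
have mB : measurable B by exact: measurable_ball.
have LB : L1 ((fun x => `|u x - u a|) \_ B).
  have := (loc_norm lv).2 (a - 2 * r) (a + 2 * r); move=> /L1_norm/L1_dom; apply.
    by apply: meas_patch => //; exact: (loc_norm lv).1.
  move=> x; rewrite patchE; case: ifPn => [/set_mem|]; last by rewrite normr0.
  rewrite /B ball_itv/= in_itv/= => /andP[x1 x2].
  rewrite normrM ler_peMr// /chi (ltW x2) (leNgt x (_ - _)) x1/=.
  by rewrite subr0 normr1.
apply: Rint_le => //.
  have := L1_norm ((loc_norm lv).2 a (a + r)).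
  by under eq_fun do rewrite normrM normr_id.
move=> x; rewrite patchE; case: ifPn => xB.
  by rewrite ler_piMr// chi_norm_le1.
have [->|/chi_neq0] := eqVneq (chi a (a + r) x) 0; first by rewrite normr0 mulr0.
move=> xr; exfalso; move: xB; rewrite notin_setE; apply.
rewrite /B /ball/= distrC (le_lt_trans xr)// addrAC subrr add0r gtr0_norm//.
lra.
Qed.

(** The derivative of the scaled step: a kernel of mass 1 on $[a,a+1/k]$, one-sided because [step]
    rises on $[0,1]$. *)
Definition moll k a x : R := k * dstep (k * (x - a)).

Lemma isD_step_scaled k a x : isD (fun x => step (k * (x - a))) x (moll k a x).
Proof.
apply: isD_eq; first apply: (isDcomp (g := fun x => k * (x - a))).
- exact: isD_step.
- by apply: isDZ; apply: isDB; [exact: isDid|exact: isDc].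
- by rewrite subr0 mulr1 mulrC.
Qed.

Lemma smooth_moll k a : smooth (moll k a).
Proof. by move=> n; apply: CnZ; apply: Cn_affine; exact: smooth_dstep. Qed.

Lemma moll_out k a x : 0 < k -> (x <= a) || (a + k^-1 <= x) -> moll k a x = 0.
Proof.
move=> k0 H; rewrite /moll dstep_out ?mulr0//; case/orP: H => H.
  by rewrite pmulr_rle0// subr_le0 H.
by rewrite -(ler_pdivrMl _ _ k0) mulr1 lerBrDl H orbT.
Qed.

Lemma test_moll k a : 0 < k -> test_function (moll k a).
Proof.
move=> k0; apply: (@support_test _ _ a (a + k^-1)); first exact: smooth_moll.
by move=> x; exact: moll_out.
Qed.

Lemma moll_le k a x : 0 < k ->
  `|moll k a x| <= k * bump_mass^-1 * `|chi a (a + k^-1) x|.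
Proof.
move=> k0; have m0 := @bump_mass_gt0 R; have [xa|xa] := boolP ((x <= a) || (a + k^-1 <= x)).
  by rewrite moll_out// normr0 mulr_ge0// mulr_ge0 ?invr_ge0// ltW.
move: xa; rewrite negb_or -!ltNge => /andP[ax xb].
rewrite /chi (ltW xb) (leNgt x a) ax subr0 normr1 mulr1 /moll ger0_norm.
  by rewrite ler_pM2l// dstep_le.
by rewrite mulr_ge0 ?dstep_ge0// ltW.
Qed.

Lemma L1_moll u k a : loc u -> 0 < k -> L1 (fun x => u x * moll k a x).
Proof.
move=> lu k0; have m0 := @bump_mass_gt0 R.
apply: (L1_dom _ (L1Z (k * bump_mass^-1) (L1_norm (lu.2 a (a + k^-1))))).
  by apply: measurable_funM; [exact: lu.1|apply: smooth_meas; exact: smooth_moll].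
move=> x; rewrite (normrM _ (moll _ _ _)) (normrM _ (chi _ _ _)) mulrCA.
rewrite ler_wpM2l//.
exact: moll_le.
Qed.

Lemma Rint_moll k a : 0 < k -> \int[mu]_x moll k a x = 1.
Proof.
move=> k0; transitivity (oint (moll k a) a (a + k^-1)).
  apply: eq_Rintegral => x _.
  have [xa|] := boolP ((x <= a) || (a + k^-1 <= x)).
    by rewrite moll_out// mul0r.
  rewrite negb_or -!ltNge => /andP[ax xb].
  by rewrite /chi (ltW xb) (leNgt x a) ax subr0 mulr1.
rewrite (oint_FTC _ _ (isD_step_scaled k a)); last by apply: smooth_cont; exact: smooth_moll.
have -> : k * (a + k^-1 - a) = 1 by field; rewrite gt_eqF.
by rewrite subrr mulr0 (@step0 _ 0)// subr0 step1.
Qed.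

(** The kernel has mass 1 and is at most [k / bump_mass] on an interval of length $1/k$. The error
    is therefore at most the mean of $|u-u(a)|$ over that interval, divided by [bump_mass]; the
    factor in [em] compensates this division. *)
Lemma cvg_moll u a : loc u -> lebesgue_pt u a ->
  (fun n => \int[mu]_x (u x * moll n.+1%:R a x)) @ \oo --> u a.
Proof.
move=> lu ua; apply/cvgrPdist_le => e e0; have m0 := @bump_mass_gt0 R.
have em : 0 < e * bump_mass by exact: mulr_gt0.
have [d d0 dP] := lebesgue_pt_le lu ua em.
near=> n; have dn : d^-1 < n%:R by near: n; exact: nbhs_infty_gtr.
set k : R := n.+1%:R; have k0 : 0 < k by rewrite ltr0n.
have kd : 0 < k^-1 < d.
  rewrite invr_gt0 k0/=; rewrite invf_plt ?posrE//.
  by rewrite (lt_trans dn)// /k ltr_nat.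
have -> : u a - \int[mu]_x (u x * moll k a x) =
    \int[mu]_x ((u a - u x) * moll k a x).
  have l1 : L1 (fun x => u a * moll k a x) by apply: L1_moll => //; exact: loc_cst.
  rewrite -[X in X - _]mulr1 -(Rint_moll a k0) -Rint_scale.
    by rewrite -Rint_sub//; [apply: eq_Rintegral => x _; rewrite mulrBl|exact: L1_moll].
  have := L1_moll a (loc_cst 1) k0.
  by under eq_fun do rewrite mul1r.
have lv : loc (fun x => u a - u x) by apply: locB => //; exact: loc_cst.
have lw : loc (fun x => u x - u a) by apply: locB => //; exact: loc_cst.
have L : L1 (fun x => `|u x - u a| * `|chi a (a + k^-1) x|).
  have := L1_norm ((loc_norm lw).2 a (a + k^-1)).
  by under eq_fun do rewrite normrM normr_id.
apply: le_trans (@Rint_norm_le _ _ (fun x => (k * bump_mass^-1) *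
    (`|u x - u a| * `|chi a (a + k^-1) x|)) _ _ _) _.
- exact: L1_moll.
- exact: L1Z.
- apply: ae_all => x; rewrite normrM distrC mulrCA ler_wpM2l//.
  exact: moll_le.
- rewrite Rint_scale//; have := dP _ kd.
  rewrite -(ler_pM2l (_ : 0 < k * bump_mass^-1)) ?mulr_gt0 ?invr_gt0//.
  move=> /le_trans; apply.
  have -> : k / bump_mass * (e * bump_mass / k) = e.
    by field; rewrite !gt_eqF.
  exact: lexx.
Unshelve. all: by end_near. Qed.

(** At a common Lebesgue point both values are limits of the same numbers, since the two functions
    have equal integrals against the test functions [moll]. *)
Lemma weak_derivative_uniq u g1 g2 : L2 g1 -> L2 g2 ->
  is_weak_derivative u g1 -> is_weak_derivative u g2 ->
  aev (fun x => g1 x = g2 x).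
Proof.
move=> l1 l2 w1 w2.
have := ae_and (ae_lebesgue_pt (L2_loc l1)) (ae_lebesgue_pt (L2_loc l2)).
move=> /ae_mono; apply => a [p1 p2].
have c1 := cvg_moll (L2_loc l1) p1; have c2 := cvg_moll (L2_loc l2) p2.
apply: (cvg_unique (@Rhausdorff R) c1); apply: cvg_trans c2.
apply: near_eq_cvg; apply: nearW => n /=; have t := @test_moll n.+1%:R a (ltr0Sn _ _).
by apply: oppr_inj; rewrite -(w1 _ t) -(w2 _ t).
Qed.

(** Convergence holds at the end points too: [step] vanishes at 0, in agreement with the half-open
    convention of [chi]. *)
Lemma cvg_cutoff a b x : a <= b ->
  (fun n => cutoff n.+1%:R a b x) @ \oo --> chi a b x.
Proof.
move=> ab.
have H d : (fun n => step (n.+1%:R * (x - d))) @ \oo --> (1 - (x <= d)%R%:R : R).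
  have [xd|dx] := leP x d.
    rewrite subrr; apply: cvg_near_cst; apply: nearW => n.
    by rewrite step0// pmulr_rle0// subr_le0.
  rewrite subr0; apply: cvg_near_cst.
  near=> n; apply: step1; rewrite -ler_pdivrMr ?subr_gt0// mul1r.
  have dn : (x - d)^-1 <= n%:R by near: n; exact: nbhs_infty_ger.
  by rewrite (le_trans dn)// ler_nat.
have -> : chi a b x = (1 - (x <= a)%R%:R) - (1 - (x <= b)%R%:R).
  by rewrite /chi; ring.
exact: cvgB (H a) (H b).
Unshelve. all: by end_near. Qed.

(* The test functions are smooth steps, whose derivatives concentrate at a and b. *)
Lemma weak_derivative_oint_pt u g a b : L2 u -> L2 g -> is_weak_derivative u g ->
  lebesgue_pt u a -> lebesgue_pt u b -> a <= b -> u b - u a = oint g a b.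
Proof.
move=> lu lg w pa pb ab; have lcu := L2_loc lu; have lcg := L2_loc lg.
have cu : ((fun n => \int[mu]_x (u x * moll n.+1%:R b x)) -
   (fun n => \int[mu]_x (u x * moll n.+1%:R a x))) @ \oo --> u b - u a.
  by apply: cvgB; exact: cvg_moll.
apply: (cvg_unique (@Rhausdorff R) cu).
have -> : ((fun n => \int[mu]_x (u x * moll n.+1%:R b x)) -
   (fun n => \int[mu]_x (u x * moll n.+1%:R a x))) =
   (fun n => \int[mu]_x (g x * cutoff n.+1%:R a b x)).
  apply/funext => n.
  have k0 : 0 < n.+1%:R :> R by rewrite ltr0n.
  have := w _ (test_cutoff k0 ab); rewrite (isD_derive1 (isD_cutoff _ _ _)).
  move=> H; rewrite -[RHS]opprK -H.
  rewrite /= -[LHS]opprK; congr (- _).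
  rewrite opprB -Rint_sub; [|exact: L1_moll|exact: L1_moll].
  by apply: eq_Rintegral => x _; rewrite mulrBr.
have mc n : measurable_fun setT (cutoff n.+1%:R a b).
  by apply: smooth_meas; exact: smooth_cutoff.
(* The cutoffs spill over [b] by $1/(n+1)\le 1$, so they are all dominated by the indicator of
   $]a,b+1]$. *)
apply: (Rint_dominated_cvg _ _ (L1_norm (lcg.2 a (b + 1)))).
- by move=> n; apply: measurable_funM => //; exact: lg.1.
- by apply: measurable_funM; [exact: lg.1|exact: L1_meas (L1_chi _ _)].
- move=> n; apply: ae_all => x; rewrite !normrM ler_wpM2l//.
  have k0 : 0 < n.+1%:R :> R by rewrite ltr0n.
  have [xa|] := boolP ((x <= a) || (b + n.+1%:R^-1 <= x)).
    by rewrite cutoff_out// normr0.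
  rewrite negb_or -!ltNge => /andP[ax xb].
  rewrite ger0_norm ?cutoff_ge0// (le_trans (cutoff_le1 _ _ _ _))//.
  rewrite /chi (leNgt x a) ax subr0 (_ : x <= b + 1) ?normr1//.
  by rewrite (le_trans (ltW xb))// lerD2l invf_le1// ler1n.
- by move=> x; apply: cvgMr; exact: cvg_cutoff.
Qed.

Lemma aev_ex (P : R -> Prop) : aev P -> exists x, P x.
Proof.
move=> aP; apply: contrapT => nP.
have [A [mA A0 sA]] := aP.
have : (mu [set` Interval (BLeft (0%R : R)) (BRight (1%R : R))] <= mu A)%E.
  by apply: le_measure; rewrite ?inE// => x _; apply: sA => /= Px; apply: nP; exists x.
by rewrite A0 lebesgue_measure_itv/= lte_fin ltr01 oppr0 adde0 lee_fin ler10.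
Qed.

(** Almost every point is a Lebesgue point of [u]; one of them is fixed to determine the constant of
    integration. *)
Lemma weak_derivative_oint u g : L2 u -> L2 g -> is_weak_derivative u g ->
  exists c, aev (fun x => u x = c + oint g 0 x).
Proof.
move=> lu lg w; have lcg := L2_loc lg.
have lp := ae_lebesgue_pt (L2_loc lu); have [a pa] := aev_ex lp.
exists (u a - oint g 0 a); apply: (ae_mono lp) => x px.
rewrite -addrA (addrC (- _)) -(oint_chasles 0 a x lcg) (addrC (oint g 0 a)) addrK.
have [ax|/ltW xa] := leP a x.
  by rewrite -(weak_derivative_oint_pt lu lg w pa px ax) addrC subrK.
rewrite ointN// -(weak_derivative_oint_pt lu lg w px pa xa).
by rewrite opprB addrC subrK.
Qed.

End weak_derivatives.

(** * Sobolev functions and the energy *)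

Section sobolev.
Context {R : realType}.
Local Notation mu := (@lebesgue_measure R).
Implicit Types (f g u v p q h k l m phi : R -> R) (x y a b c M : R).

Lemma L1_ext f g : L1 f -> (forall x, f x = g x) -> L1 g.
Proof. by move=> lf fg; have -> : g = f by apply/funext => x; rewrite fg. Qed.

Lemma L2_ext f g : L2 f -> (forall x, f x = g x) -> L2 g.
Proof. by move=> lf fg; have -> : g = f by apply/funext => x; rewrite fg. Qed.

Lemma compact_support_L1 f M : continuous f -> 0 <= M ->
  (forall x, M <= `|x| -> f x = 0) ->
  L1 f /\ \int[mu]_x f x = oint f (- M) M.
Proof.
move=> cf M0 f0.
have H x : f x * chi (- M) M x = f x.
  have [Mx|xM] := leP M `|x|; first by rewrite f0// mul0r.
  move: xM; rewrite ltr_norml /chi => /andP[Mx /ltW ->].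
  by rewrite (leNgt x (- M)) Mx subr0 mulr1.
split; last by apply: eq_Rintegral => x _; rewrite H.
exact: (L1_ext ((loc_continuous cf).2 (- M) M)).
Qed.

Lemma test_support phi : test_function phi ->
  exists2 M, 0 <= M & forall x, M <= `|x| -> phi x = 0.
Proof.
move=> [_ /compact_bounded[M [_ /(_ (`|M| + 1))KM]]].
exists (`|M| + 2); first by rewrite addr_ge0.
move=> x Mx; apply/eqP; apply: contraLR Mx => px; rewrite -ltNge.
have := KM _ x; rewrite ltr_pwDr ?ler_norm//.
move=> /(_ isT) H; apply: le_lt_trans (H _) _; last by rewrite ltrD2l ltr1n.
by apply: subset_closure.
Qed.

Lemma test_smooth phi : test_function phi -> smooth phi.
Proof. by move=> [/smoothP]. Qed.

Lemma test_L2 phi : test_function phi -> L2 phi.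
Proof.
move=> tp; have sp := test_smooth tp; have [M M0 phi0] := test_support tp.
split; first exact: smooth_meas.
apply: (@compact_support_L1 _ M _ M0 _).1.
  by apply: smooth_cont => n; apply: CnM; exact: sp.
by move=> x Mx; rewrite phi0// expr0n.
Qed.

Lemma test_derive1 phi : test_function phi -> test_function (derive1 phi).
Proof.
move=> tp; have sp := test_smooth tp; have [M M0 phi0] := test_support tp.
apply: (@support_test _ _ (- M - 1) (M + 1)); first exact: smooth_derive1.
move=> x Mx; have [_ <-] := smooth_isD x sp.
suff [_ ->] : isD phi x 0 by [].
apply: (@isD_near _ (fun=> 0)); last exact: isDc.
near=> y; rewrite phi0//.
have : `|x - y| < 1 by near: y; apply/nbhs_ballP; exists 1 => //=.
rewrite ltr_norml => /andP[y1 y2].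
by case/orP: Mx => Mx; [rewrite ler0_norm|rewrite ger0_norm]; lra.
Unshelve. all: by end_near. Qed.

Lemma test_ibp F f phi : (forall x, isD F x (f x)) -> continuous f ->
  test_function phi ->
  \int[mu]_x (F x * derive1 phi x) = - \int[mu]_x (f x * phi x).
Proof.
move=> dF cf tp; have sp := test_smooth tp.
have [M M0 phi0] := test_support tp; have td := test_derive1 tp.
have [N N0 dphi0] := test_support td.
have cF : continuous F by move=> x; exact: isD_cont (dF x).
have cp := smooth_cont sp; have cdp := smooth_cont (test_smooth td).
pose L := M + N; have L0 : 0 <= L by rewrite addr_ge0.
have s1 x : L <= `|x| -> F x * derive1 phi x = 0.
  by move=> Lx; rewrite dphi0 ?mulr0// (le_trans _ Lx)// lerDr.
have s2 x : L <= `|x| -> f x * phi x = 0.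
  by move=> Lx; rewrite phi0 ?mulr0// (le_trans _ Lx)// lerDl.
have c1 : continuous (fun x => F x * derive1 phi x).
  by move=> x; apply: cvgM; [exact: cF|exact: cdp].
have c2 : continuous (fun x => f x * phi x).
  by move=> x; apply: cvgM; [exact: cf|exact: cp].
have [l1 _] := compact_support_L1 c1 L0 s1.
have [l2 _] := compact_support_L1 c2 L0 s2.
apply/eqP; rewrite -addr_eq0 addrC -Rint_add//.
have s3 x : L <= `|x| -> f x * phi x + F x * derive1 phi x = 0.
  by move=> Lx; rewrite s1// s2// addr0.
have c3 : continuous (fun x => f x * phi x + F x * derive1 phi x).
  by move=> x; apply: cvgD; [exact: c2|exact: c1].
have [_ ->] := compact_support_L1 c3 L0 s3.
rewrite (@oint_FTC _ (fun x => F x * phi x)) //.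
  by rewrite !phi0 ?mulr0 ?subrr ?normrN ?ger0_norm ?lerDl.
by move=> x; apply: isDM; [exact: dF|exact: smooth_isD].
Qed.

(** The weak derivative is carried explicitly, since [wderiv] is an arbitrary choice, known only
    almost everywhere through [sob_wderiv]. *)
Definition sob u p := [/\ L2 u, L2 p & is_weak_derivative u p].

Lemma sob_W12 u p : sob u p -> W12 u.
Proof.
by move=> [lu lp w]; split; [exact/L2_Lfun|exists p => //; exact/L2_Lfun].
Qed.

Lemma W12_sob u : W12 u -> sob u (wderiv u).
Proof.
move=> [lu [g lg wg]].
have [] : [set g | g \in Lfun mu 2%:E /\ is_weak_derivative u g] (wderiv u).
  by apply: xgetPex; exists g; split.
by move=> lw w; split => //; exact/L2_Lfun.
Qed.

Lemma sob_wderiv u p : sob u p -> aev (fun x => wderiv u x = p x).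
Proof.
move=> sp; have [lu lw w] := W12_sob (sob_W12 sp); have [_ lp wp] := sp.
exact: weak_derivative_uniq w wp.
Qed.

Lemma sob_lin u p h k (t : R) : sob u p -> sob h k ->
  sob (fun x => u x + t * h x) (fun x => p x + t * k x).
Proof.
move=> [lu lp w] [lh lk wh]; split.
- by apply: L2D => //; exact: L2Z.
- by apply: L2D => //; exact: L2Z.
- move=> phi tp; have l0 := test_L2 tp; have l1 := test_L2 (test_derive1 tp).
  under eq_Rintegral do rewrite mulrDl -mulrA.
  under [in RHS]eq_Rintegral do rewrite mulrDl -mulrA.
  rewrite !Rint_add ?Rint_scale; try by [exact: L2_mul|apply: L1Z; exact: L2_mul].
  by rewrite w// wh// opprD mulrN.
Qed.

Lemma sob_test phi : test_function phi -> sob phi (derive1 phi).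
Proof.
move=> tp; have td := test_derive1 tp; split; [exact: test_L2|exact: test_L2|].
move=> psi; apply: test_ibp; last exact: smooth_cont (test_smooth td).
by move=> x; apply: smooth_isD; exact: test_smooth.
Qed.

Lemma sob0 : sob (fun=> 0) (fun=> 0).
Proof.
have l0 : L2 (fun=> 0 : R).
  split; first exact: measurable_cst.
  by under eq_fun do rewrite expr0n/=; exact: integrable0.
split => // phi _; under eq_Rintegral do rewrite mul0r.
under [in RHS]eq_Rintegral do rewrite mul0r.
by rewrite Rintegral_cst// mul0r oppr0.
Qed.

(** The Sobolev embedding on the line: $u(x)=u(y)-\int_x^y p$ and Cauchy-Schwarz give $u(x)^2\le
    2u(y)^2+2\int p^2$ for $|x-y|\le 1$, and this is averaged over $y$ in $]x,x+1]$. *)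
Lemma sob_bound u p : sob u p -> aev (fun x =>
  u x ^+ 2 <= 2 * \int[mu]_x (u x ^+ 2) + 2 * \int[mu]_x (p x ^+ 2)).
Proof.
move=> [lu lp w]; have [c uc] := weak_derivative_oint lu lp w.
have lcp := L2_loc lp; set G := \int[mu]_x (p x ^+ 2).
apply: (ae_mono uc) => x ->; set U := fun x => c + oint p 0 x.
have UU y : `|y - x| <= 1 -> U x ^+ 2 <= 2 * U y ^+ 2 + 2 * G.
  move=> xy; have G0 : 0 <= G by apply: Rint_ge0 => z; exact: sqr_ge0.
  have : oint p x y ^+ 2 <= G.
    by apply: (le_trans (oint_sqr x y lp)); rewrite ler_piMl.
  have -> : U x = U y - oint p x y.
    by rewrite /U -(oint_chasles 0 x y lcp); ring.
  have := sqr_ge0 (U y + oint p x y); nra.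
have -> : (c + oint p 0 x) ^+ 2 =
    \int[mu]_y (U x ^+ 2 * chi x (x + 1) y).
  by rewrite Rint_scale ?Rint_chi; [rewrite addrAC subrr add0r mulr1|exact: L1_chi].
have -> : 2 * \int[mu]_y (u y ^+ 2) + 2 * G =
    \int[mu]_y (2 * u y ^+ 2 + 2 * G * chi x (x + 1) y).
  have lu2 : L1 (fun y => u y ^+ 2) by case: lu.
  have lc := L1_chi x (x + 1).
  rewrite (Rint_add (L1Z 2 lu2) (L1Z (2 * G) lc)) (Rint_scale 2 lu2) (Rint_scale (2 * G) lc) Rint_chi.
  by rewrite addrAC subrr add0r mulr1.
apply: Rint_ae_le.
- by apply: L1Z; exact: L1_chi.
- by apply: L1D; apply: L1Z; [case: lu|exact: L1_chi].
- apply: (ae_mono uc) => y uy; rewrite chiE ?lerDl// indicE mem_setE in_itv/=.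
  case: (boolP (x < y <= x + 1)) => [/andP[xy yx]|_]; last first.
    by rewrite !mulr0 addr0 mulr_ge0 ?sqr_ge0.
  rewrite !mulr1 uy; apply: UU; rewrite ger0_norm; lra.
Qed.

Lemma sob_bd u p : sob u p -> exists2 M, 0 <= M & aev (fun x => `|u x| <= M).
Proof.
move=> sp; have := sob_bound sp; set B := _ + _ => H.
have B0 : 0 <= B by rewrite addr_ge0 ?mulr_ge0 ?Rint_ge0// => x; exact: sqr_ge0.
exists (Num.sqrt B); first exact: sqrtr_ge0.
by apply: (ae_mono H) => x uB; rewrite -sqrtr_sqr ler_wsqrtr.
Qed.

(** Sobolev functions are bounded, so products stay in $L^2$; the cubic and quartic terms of the
    energy are integrable for this reason. *)
Lemma sob_L2M u p f : sob u p -> L2 f -> L2 (fun x => u x * f x).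
Proof.
move=> sp lf; have [M _ uM] := sob_bd sp; have [lu _ _] := sp.
exact: L2_bdM (L2_meas lu) uM lf.
Qed.

Lemma sqnormE (lambda : R) u p : sob u p ->
  sqnorm lambda u = \int[mu]_x (p x ^+ 2 + lambda * u x ^+ 2).
Proof.
move=> sp; have [lu lw _] := W12_sob (sob_W12 sp); have [_ lp _] := sp.
apply: Rint_ae_eq.
- by apply: L1_meas; apply: L1D; [case: lw|apply: L1Z; case: lu].
- by apply: L1_meas; apply: L1D; [case: lp|apply: L1Z; case: lu].
- by apply: (ae_mono (sob_wderiv sp)) => x ->.
Qed.

End sobolev.

(** * The energy functional, its derivative and its critical points *)

Section energy.
Context {R : realType}.
Local Notation mu := (@lebesgue_measure R).
Context (lambda beta : R) (lambda_gt0 : 0 < lambda).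
Implicit Types (f g u v p q h k l m phi : R -> R) (x y a b c d M : R).

(* The arguments a, b, c, d stand for u, u', v, v', and a', b', c', d' for an
   increment; [dens], [ndens] and [ddens] are the integrands of Phi, of the squared
   norm and of the derivative of Phi; [edens] is that of Phi - Phi'(u)u / 3. *)
Definition ndens a b c d : R := (b ^+ 2 + lambda * a ^+ 2) + (d ^+ 2 + lambda * c ^+ 2).

Definition dens a b c d : R :=
  2^-1 * (b ^+ 2 + lambda * a ^+ 2) - 4^-1 * a ^+ 4
  + 2^-1 * (d ^+ 2 + lambda * c ^+ 2) - 6^-1 * c ^+ 3
  - 2^-1 * beta * (a ^+ 2 * c).

Definition ddens a b c d a' b' c' d' : R :=
  (b * b' + lambda * (a * a')) + (d * d' + lambda * (c * c'))
  - a ^+ 3 * a' - 2^-1 * (c ^+ 2 * c') - beta * (a * c * a')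
  - 2^-1 * beta * (a ^+ 2 * c').

Definition edens a b c d : R := 6^-1 * ndens a b c d + 12^-1 * a ^+ 4.

Lemma ndens_ge0 a b c d : 0 <= ndens a b c d.
Proof.
have l0 := ltW lambda_gt0.
by apply: addr_ge0; apply: addr_ge0;
  first [exact: sqr_ge0 | apply: mulr_ge0 => //; exact: sqr_ge0].
Qed.

Lemma L1_ndens u p v q : sob u p -> sob v q ->
  L1 (fun x => ndens (u x) (p x) (v x) (q x)).
Proof.
move=> [lu lp _] [lv lq _]; apply: L1D; apply: L1D; try apply: L1Z.
- by case: lp.
- by case: lu.
- by case: lq.
- by case: lv.
Qed.

Lemma L1_pow4 u p : sob u p -> L1 (fun x => u x ^+ 4).
Proof.
move=> sp; have [lu _ _] := sp; have l2 := sob_L2M sp lu.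
by apply: (L1_ext (L2_mul l2 l2)) => x; ring.
Qed.

Lemma L1_pow3 u p : sob u p -> L1 (fun x => u x ^+ 3).
Proof.
move=> sp; have [lu _ _] := sp; have l2 := sob_L2M sp lu.
by apply: (L1_ext (L2_mul l2 lu)) => x; ring.
Qed.

Lemma L1_pow21 u p v q : sob u p -> sob v q -> L1 (fun x => u x ^+ 2 * v x).
Proof.
move=> sp [lv _ _]; have [lu _ _] := sp; have l2 := sob_L2M sp lu.
by apply: (L1_ext (L2_mul l2 lv)) => x; ring.
Qed.

Lemma L1_edens u p v q : sob u p -> sob v q ->
  L1 (fun x => edens (u x) (p x) (v x) (q x)).
Proof.
move=> sp sq; apply: L1D; apply: L1Z; [exact: L1_ndens|exact: L1_pow4 sp].
Qed.

Lemma L1_ddens u p v q h k l m : sob u p -> sob v q -> sob h k -> sob l m ->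
  L1 (fun x => ddens (u x) (p x) (v x) (q x) (h x) (k x) (l x) (m x)).
Proof.
move=> sp sq [lh lk _] [ll lm _]; have [lu lp _] := sp; have [lv lq _] := sq.
have luu := sob_L2M sp lu; have luh := sob_L2M sp lh.
have lvv := sob_L2M sq lv; have luv := sob_L2M sp lv.
rewrite /ddens; repeat first [apply: L1B | apply: L1D | apply: L1Z].
- exact: L2_mul.
- exact: L2_mul.
- exact: L2_mul.
- exact: L2_mul.
- by apply: (L1_ext (L2_mul luu luh)) => x; ring.
- by apply: (L1_ext (L2_mul lvv ll)) => x; ring.
- exact: L2_mul luv lh.
- by apply: (L1_ext (L2_mul luu ll)) => x; ring.
Qed.

Lemma L1_dens u p v q : sob u p -> sob v q ->
  L1 (fun x => dens (u x) (p x) (v x) (q x)).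
Proof.
move=> sp sq; have [lu lp _] := sp; have [lv lq _] := sq.
rewrite /dens; repeat first [apply: L1B | apply: L1D | apply: L1Z].
- by case: lp.
- by case: lu.
- exact: L1_pow4 sp.
- by case: lq.
- by case: lv.
- exact: L1_pow3 sq.
- exact: L1_pow21 sp sq.
Qed.

Lemma PhiE u p v q : sob u p -> sob v q ->
  Phi lambda lambda beta (u, v) =
  \int[mu]_x dens (u x) (p x) (v x) (q x).
Proof.
move=> sp sq; have [lu lp _] := sp; have [lv lq _] := sq.
rewrite /Phi /= (sqnormE _ sp) (sqnormE _ sq) /dens.
have [l1 l2 l3] := And3 (L1_pow4 sp) (L1_pow3 sq) (L1_pow21 sp sq).
have l4 : L1 (fun x => p x ^+ 2 + lambda * u x ^+ 2).
  by apply: L1D; [case: lp|apply: L1Z; case: lu].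
have l5 : L1 (fun x => q x ^+ 2 + lambda * v x ^+ 2).
  by apply: L1D; [case: lq|apply: L1Z; case: lv].
have L4 := L1Z 2^-1 l4; have L5 := L1Z 2^-1 l5.
have L1' := L1Z 4^-1 l1; have L2' := L1Z 6^-1 l2.
have L3' := L1Z (2^-1 * beta) l3.
have M1 := L1B L4 L1'; have M2 := L1D M1 L5; have M3 := L1B M2 L2'.
by rewrite (Rint_sub M3 L3') (Rint_sub M2 L2') (Rint_add M1 L5) (Rint_sub L4 L1') !Rint_scale.
Qed.

Lemma normEEE u p v q : sob u p -> sob v q ->
  normEE lambda lambda (u, v) =
  Num.sqrt (\int[mu]_x ndens (u x) (p x) (v x) (q x)).
Proof.
move=> sp sq; have [lu lp _] := sp; have [lv lq _] := sq.
rewrite /normEE /= (sqnormE _ sp) (sqnormE _ sq) -Rint_add//.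
  by apply: L1D; [case: lp|apply: L1Z; case: lu].
by apply: L1D; [case: lq|apply: L1Z; case: lv].
Qed.

(** The remainder is half of [ndens] plus terms containing $a'^2$, $c'^2$ or $a'c'$, whose cofactors
    are bounded in terms of [M] and [beta]. Division by [lambda] turns $a'^2+c'^2$ into a multiple
    of [ndens]. No bound on [b], [d], [b'], [d'] is available, and they enter only quadratically. *)
Lemma dens_taylor M : 0 <= M -> exists2 K, 0 <= K &
  forall a b c d a' b' c' d', `|a| <= M -> `|c| <= M -> `|a'| <= M -> `|c'| <= M ->
  `|dens (a + a') (b + b') (c + c') (d + d') - dens a b c d
    - ddens a b c d a' b' c' d'| <= K * ndens a' b' c' d'.
Proof.
move=> M0; set B := `|beta|.
pose N := 4 * M ^+ 2 + 4 * M + 4 * B * M.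
have B0 : 0 <= B by exact: normr_ge0.
have N0 : 0 <= N by rewrite /N !addr_ge0// !mulr_ge0.
exists (1 + N / lambda); first by rewrite addr_ge0// divr_ge0// ltW.
move=> a b c d a' b' c' d'; rewrite !ler_norml.
move=> /andP[a1 a2] /andP[c1 c2] /andP[x1 x2] /andP[y1 y2].
have -> : dens (a + a') (b + b') (c + c') (d + d') - dens a b c d
    - ddens a b c d a' b' c' d' =
    2^-1 * ndens a' b' c' d'
    - a' ^+ 2 * (3 / 2 * a ^+ 2 + a * a' + 4^-1 * a' ^+ 2)
    - c' ^+ 2 * (2^-1 * c + 6^-1 * c')
    - beta * (a * (a' * c')) - a' ^+ 2 * (beta * (2^-1 * c + 2^-1 * c')).
  by rewrite /dens /ddens /ndens; field.
set A := a' ^+ 2; set C := c' ^+ 2; set n := ndens _ _ _ _.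
have A0 : 0 <= A := sqr_ge0 _; have C0 : 0 <= C := sqr_ge0 _.
have nAC : lambda * (A + C) <= n.
  rewrite /n /ndens -/A -/C; have := sqr_ge0 b'; have := sqr_ge0 d'; lra.
have {}nAC : N * (A + C) <= N / lambda * n.
  by rewrite -mulrA ler_wpM2l// mulrC ler_pdivlMr// mulrC.
have n0 : 0 <= n := ndens_ge0 _ _ _ _.
have M2 : 0 <= M ^+ 2 := sqr_ge0 _.
have H1 : `|A * (3 / 2 * a ^+ 2 + a * a' + 4^-1 * A)| <= A * (4 * M ^+ 2).
  rewrite normrM (ger0_norm A0) ler_wpM2l// ler_norml.
  have h1 : 0 <= a ^+ 2 <= M ^+ 2 by rewrite sqr_ge0/=; nra.
  have h2 : 0 <= A <= M ^+ 2 by rewrite A0 /A; nra.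
  have h3 : - M ^+ 2 <= a * a' <= M ^+ 2 by apply/andP; split; nra.
  lra.
have H2 : `|C * (2^-1 * c + 6^-1 * c')| <= C * M.
  by rewrite normrM (ger0_norm C0) ler_wpM2l// ler_norml; lra.
have H3 : `|beta * (a * (a' * c'))| <= B * M * (A + C).
  rewrite normrM -mulrA ler_wpM2l// normrM ler_pM// ler_norml; first lra.
  rewrite /A /C; nra.
have H4 : `|A * (beta * (2^-1 * c + 2^-1 * c'))| <= A * (B * M).
  rewrite normrM (ger0_norm A0) ler_wpM2l// normrM ler_wpM2l// ler_norml; lra.
move: H1 H2 H3 H4; rewrite !ler_norml => /andP[? ?] /andP[? ?] /andP[? ?] /andP[? ?].
have MA : 0 <= A * M by exact: mulr_ge0.
have MC : 0 <= C * M by exact: mulr_ge0.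
have MA2 : 0 <= A * M ^+ 2 by exact: mulr_ge0.
have MC2 : 0 <= C * M ^+ 2 by exact: mulr_ge0.
have BM0 : 0 <= B * M by exact: mulr_ge0.
have BA : 0 <= A * (B * M) by exact: mulr_ge0.
have BC : 0 <= C * (B * M) by exact: mulr_ge0.
have : (4 * M ^+ 2 + 4 * M + 4 * B * M) * (A + C) <= N / lambda * n by [].
set W := N / lambda * n; set V := _ * (A + C) => VW.
have -> : (1 + N / lambda) * n = n + W by rewrite mulrDl mul1r.
rewrite /V in VW; clearbody W; lra.
Qed.

(** The hypothesis gives $\int h^2\le 1/\lambda$ and $\int k^2\le 1$, so $h^2\le 2+2/\lambda$ by
    [sob_bound]. Since $(3+2/\lambda)^2$ exceeds this number, the stated bound avoids a square
    root. *)
Lemma sob_bound_ndens h k l m : sob h k -> sob l m ->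
  \int[mu]_x ndens (h x) (k x) (l x) (m x) <= 1 ->
  aev (fun x => `|h x| <= 3 + 2 / lambda /\ `|l x| <= 3 + 2 / lambda).
Proof.
move=> sh sl n1; have [lh lk _] := sh; have [ll lm _] := sl.
have lh2 : L1 (fun x => h x ^+ 2) by case: lh.
have lk2 : L1 (fun x => k x ^+ 2) by case: lk.
have ll2 : L1 (fun x => l x ^+ 2) by case: ll.
have lm2 : L1 (fun x => m x ^+ 2) by case: lm.
have n1' : (\int[mu]_x (k x ^+ 2) + lambda * \int[mu]_x (h x ^+ 2)) +
    (\int[mu]_x (m x ^+ 2) + lambda * \int[mu]_x (l x ^+ 2)) <= 1.
  have a1 := L1Z lambda lh2; have a2 := L1Z lambda ll2.
  move: n1; rewrite /ndens (Rint_add (L1D lk2 a1) (L1D lm2 a2)).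
  by rewrite (Rint_add lk2 a1) (Rint_add lm2 a2) !Rint_scale.
have := ae_and (sob_bound sh) (sob_bound sl).
move: n1'; set H := \int[mu]_x (h x ^+ 2); set K := \int[mu]_x (k x ^+ 2).
set L := \int[mu]_x (l x ^+ 2); set M := \int[mu]_x (m x ^+ 2) => n1'.
have [H0 K0] : 0 <= H /\ 0 <= K by split; apply: Rint_ge0 => x; exact: sqr_ge0.
have [L0 M0] : 0 <= L /\ 0 <= M by split; apply: Rint_ge0 => x; exact: sqr_ge0.
have lH : 0 <= lambda * H by rewrite mulr_ge0// ltW.
have lL : 0 <= lambda * L by rewrite mulr_ge0// ltW.
have Hl : H <= 1 / lambda by rewrite ler_pdivlMr// mulrC; lra.
have Ll : L <= 1 / lambda by rewrite ler_pdivlMr// mulrC; lra.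
have i0 : 0 <= 1 / lambda by rewrite divr_ge0// ltW.
move=> /ae_mono; apply => x [hx lx].
have -> : 2 / lambda = 2 * (1 / lambda) by rewrite mul1r.
move: (1 / lambda) Hl Ll i0 => i Hi Li i0.
by split; rewrite ler_norml; apply/andP; split; nra.
Qed.

(** On the unit ball of the norm the increments are uniformly bounded, so [dens_taylor] applies
    pointwise with a single constant and can be integrated. *)
Lemma Phi_taylor u p v q : sob u p -> sob v q -> exists2 K, 0 <= K &
  forall h k l m, sob h k -> sob l m ->
  \int[mu]_x ndens (h x) (k x) (l x) (m x) <= 1 ->
  `|Phi lambda lambda beta ((u, v) + (h, l)) - Phi lambda lambda beta (u, v) -
    \int[mu]_x ddens (u x) (p x) (v x) (q x) (h x) (k x) (l x) (m x)| <=
    K * \int[mu]_x ndens (h x) (k x) (l x) (m x).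
Proof.
move=> sp sq; have [M1 M10 uM] := sob_bd sp; have [M2 M20 vM] := sob_bd sq.
pose M3 := 3 + 2 / lambda.
have M30 : 0 <= M3 by rewrite addr_ge0// divr_ge0// ltW.
have MM : 0 <= M1 + M2 + M3 := addr_ge0 (addr_ge0 M10 M20) M30.
have [K K0 KP] := dens_taylor MM; exists K => // h k l m sh sl n1.
have sph := sob_lin 1 sp sh; have sql := sob_lin 1 sq sl.
have -> : (u, v) + (h, l) = (fun x => u x + 1 * h x, fun x => v x + 1 * l x).
  by congr pair; apply/funext => x; rewrite mul1r.
have d1 := L1_dens sph sql; have d0 := L1_dens sp sq.
have dd := L1_ddens sp sq sh sl.
rewrite (PhiE sph sql) (PhiE sp sq) -(Rint_sub d1 d0) -(Rint_sub (L1B d1 d0) dd).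
have ln := L1_ndens sh sl; rewrite -(Rint_scale K ln).
apply: Rint_norm_le; [exact: L1B (L1B d1 d0) dd|exact: L1Z|].
have := ae_and (ae_and uM vM) (sob_bound_ndens sh sl n1).
move=> /ae_mono; apply => x [[ux vx] [hx lx]]; rewrite !mul1r.
have W y N : `|y| <= N -> N <= M1 + M2 + M3 -> `|y| <= M1 + M2 + M3.
  exact: le_trans.
by apply: KP; [apply: W ux _|apply: W vx _|apply: W hx _|apply: W lx _];
  rewrite -/M3; lra.
Qed.

Definition crit u p v q := forall h k l m, sob h k -> sob l m ->
  \int[mu]_x ddens (u x) (p x) (v x) (q x) (h x) (k x) (l x) (m x) = 0.

Lemma Rint_ddensZ u p v q h k l m (t : R) : sob u p -> sob v q -> sob h k -> sob l m ->
  \int[mu]_x ddens (u x) (p x) (v x) (q x) (t * h x) (t * k x) (t * l x) (t * m x) =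
  t * \int[mu]_x ddens (u x) (p x) (v x) (q x) (h x) (k x) (l x) (m x).
Proof.
move=> sp sq sh sl; rewrite -(Rint_scale t (L1_ddens sp sq sh sl)).
by apply: eq_Rintegral => x _; rewrite /ddens; ring.
Qed.

Lemma sobZ h k (t : R) : sob h k -> sob (fun x => t * h x) (fun x => t * k x).
Proof.
move=> sh; have := sob_lin t sob0 sh.
by under eq_fun do rewrite add0r; under [X in sob _ X]eq_fun do rewrite add0r.
Qed.

(** The remainder in [Phi_taylor] is quadratic in the norm. If the first-order term vanishes, the
    derivative is therefore 0; conversely that term is isolated by inserting small multiples
    $t(h,l)$ and dividing by $t$. *)
Lemma crit_frechet u p v q : sob u p -> sob v q ->
  (is_frechet_derivative (normEE lambda lambda) (Phi lambda lambda beta)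
    (u, v) (fun=> 0) <-> crit u p v q).
Proof.
move=> sp sq; have [K K0 KP] := Phi_taylor sp sq; split=> [[_ F]|C]; last first.
  split.
    split=> [a h k _ _|]; first by rewrite mulr0 addr0.
    by exists 0 => h _; rewrite normr0 mul0r.
  move=> e e0; have K1 : 0 < K + 1 by rewrite ltr_wpDl.
  exists (Num.min 1 (e / (K + 1))); first by rewrite lt_min ltr01 divr_gt0.
  move=> [h l] [/= /W12_sob sh /W12_sob sl]; rewrite (normEEE sh sl) lt_min.
  have := KP _ _ _ _ sh sl; rewrite (C _ _ _ _ sh sl) !subr0.
  set S := \int[mu]_x _; have S0 : 0 <= S by apply: Rint_ge0 => x; exact: ndens_ge0.
  have -> : S = Num.sqrt S ^+ 2 by rewrite sqr_sqrtr.
  have := sqrtr_ge0 S; move: (Num.sqrt S) => {S S0} N N0 H.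
  rewrite sqrtr_sqr ger0_norm// => /andP[N1 Ne].
  have {}H := H _; apply: le_trans (H _) _; first by rewrite exprn_ile1// ltW.
  rewrite expr2 mulrA ler_wpM2r//; move: Ne; rewrite ltr_pdivlMr// => Ne.
  by have := ltW Ne; rewrite mulrDr mulr1 (mulrC K); lra.
move=> h k l m sh sl; set a := \int[mu]_x _.
have ln := L1_ndens sh sl; set S := \int[mu]_x ndens (h x) (k x) (l x) (m x).
have S0 : 0 <= S by apply: Rint_ge0 => x; exact: ndens_ge0.
pose N := Num.sqrt S; have N0 : 0 <= N by exact: sqrtr_ge0.
have NS : N ^+ 2 = S by rewrite sqr_sqrtr.
suff H e : 0 < e -> `|a| <= e.
  apply/eqP; rewrite -normr_le0; apply/ler_addgt0Pr => e e0.
  by rewrite add0r; exact: H.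
move=> e0; pose e1 := e / (2 * (N + 1)).
have N1 : 0 < N + 1 by rewrite ltr_wpDl.
have e10 : 0 < e1 by rewrite divr_gt0// mulr_gt0.
have [d d0 dP] := F e1 e10.
(* One summand for each smallness condition on $t=1/D$: $tN\le 1$, $tN<d$ and $KSt\le e/2$. *)
pose D := 1 + N + N / d + 2 * K * S / e.
have Nd0 : 0 <= N / d by rewrite divr_ge0// ltW.
have KS0 : 0 <= 2 * K * S / e by rewrite divr_ge0 ?mulr_ge0// ltW.
have D0 : 0 < D by rewrite /D; lra.
pose t := D^-1; have t0 : 0 < t by rewrite invr_gt0.
have tN1 : t * N <= 1 by rewrite mulrC ler_pdivrMr// mul1r /D; lra.
have tNd : t * N < d.
  rewrite mulrC ltr_pdivrMr// mulrC -ltr_pdivrMr// /D; lra.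
have tK : K * S * t <= e / 2.
  rewrite ler_pdivrMr// -ler_pdivrMl ?divr_gt0//.
  have -> : (e / 2)^-1 * (K * S) = 2 * K * S / e by field; rewrite gt_eqF.
  rewrite /D; lra.
have sth := sobZ t sh; have stl := sobZ t sl.
have St : \int[mu]_x ndens (t * h x) (t * k x) (t * l x) (t * m x) = t ^+ 2 * S.
  by rewrite -(Rint_scale _ ln); apply: eq_Rintegral => x _; rewrite /ndens; ring.
have Nt : normEE lambda lambda (fun x => t * h x, fun x => t * l x) = t * N.
  by rewrite (normEEE sth stl) St -NS -exprMn sqrtr_sqr ger0_norm// mulr_ge0// ltW.
have := dP (fun x => t * h x, fun x => t * l x).
rewrite Nt subr0 => /(_ _ tNd) H.
have {}H := H (conj (sob_W12 sth) (sob_W12 stl)).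
have := KP _ _ _ _ sth stl; rewrite St (Rint_ddensZ _ sp sq sh sl) -/a => G.
have t2S : t ^+ 2 * S <= 1 by rewrite -NS -exprMn exprn_ile1// mulr_ge0// ltW.
have {G} := G t2S; move: H; set X := Phi _ _ _ _ - Phi _ _ _ _ => H G.
have {H G} : `|t * a| <= e1 * (t * N) + K * (t ^+ 2 * S).
  have -> : t * a = X - (X - t * a) by ring.
  by rewrite (le_trans (ler_normB _ _))// lerD.
rewrite normrM (gtr0_norm t0).
have -> : e1 * (t * N) + K * (t ^+ 2 * S) = t * (e1 * N + K * S * t) by ring.
rewrite ler_pM2l// => /le_trans; apply.
have : e1 * N <= e / 2; last lra.
rewrite /e1; have -> : e / (2 * (N + 1)) * N = e / 2 * (N / (N + 1)).
  by field; rewrite gt_eqF.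
apply: ler_piMr; first by rewrite divr_ge0// ltW.
by rewrite ler_pdivrMr// mul1r lerDl.
Qed.

Lemma bound_stateP u v :
  bound_state lambda lambda beta (u, v) <->
  exists p q, [/\ sob u p, sob v q, ~ null_pair (u, v) & crit u p v q].
Proof.
split=> [[[/= /W12_sob su /W12_sob sv] nn F]|[p [q [su sv nn C]]]].
  by exists (wderiv u), (wderiv v); split => //; exact/crit_frechet.
split => //; last exact/(crit_frechet su sv).
by split; [exact: sob_W12 su|exact: sob_W12 sv].
Qed.

(** The factor $1/3$ removes the terms of degree three, which have no sign. The coefficients left
    are $1/2-1/3=1/6$ on the quadratic part and $1/3-1/4=1/12$ on $u^4$. *)
Lemma crit_energy u p v q : sob u p -> sob v q -> crit u p v q ->
  Phi lambda lambda beta (u, v) = \int[mu]_x edens (u x) (p x) (v x) (q x).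
Proof.
move=> su sv C; have ld := L1_ddens su sv su sv.
rewrite (PhiE su sv) -[LHS]subr0 -[X in _ - X](mulr0 (3^-1)) -(C _ _ _ _ su sv).
rewrite -(Rint_scale _ ld) -(Rint_sub (L1_dens su sv) (L1Z _ ld)).
by apply: eq_Rintegral => x _; rewrite /dens /ddens /edens /ndens; field.
Qed.

(* The equation is tested with the solution itself. *)
Lemma crit_not_small : exists2 d, 0 < d & forall u p v q,
  sob u p -> sob v q -> ~ null_pair (u, v) -> crit u p v q ->
  ~ aev (fun x => u x ^+ 2 + v x ^+ 2 <= d).
Proof.
pose B := `|beta|; have B0 : 0 <= B by exact: normr_ge0.
(* Chosen so that $s\le 1$ and $s(2+4B)\le\lambda$. If $u^2+v^2\le s^2$, then $u^2\le s$ and $|v|\le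
   s$, and the nonlinear terms are absorbed, leaving an integrand of at least
   $\frac{\lambda}{4}(u^2+v^2)$. *)
pose s := lambda / (lambda + 2 + 4 * B).
have D0 : 0 < lambda + 2 + 4 * B by rewrite !ltr_wpDr ?mulr_ge0.
have s0 : 0 < s by exact: divr_gt0.
have s1 : s <= 1.
  by rewrite ler_pdivrMr// mul1r -addrA lerDl addr_ge0// mulr_ge0.
have sl : s * (2 + 4 * B) <= lambda.
  rewrite /s mulrAC ler_pdivrMr//; apply: ler_wpM2l; first exact: ltW.
  by rewrite -[leRHS]addrA lerDr ltW.
exists (s ^+ 2); first exact: exprn_gt0.
move=> u p v q su sv nn C small; apply: nn.
have [lu lp _] := su; have [lv lq _] := sv.
have l0 : L1 (fun x => lambda / 4 * (u x ^+ 2 + v x ^+ 2)).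
  by apply: L1Z; apply: L1D; [case: lu|case: lv].
have le : \int[mu]_x (lambda / 4 * (u x ^+ 2 + v x ^+ 2)) <= 0.
  rewrite -(C _ _ _ _ su sv); apply: Rint_ae_le => //.
    exact: L1_ddens.
  apply: (ae_mono small) => x; rewrite /ddens.
  set a := u x; set c := v x; set b := p x; set d := q x => h.
  have A0 := sqr_ge0 a; have C0 := sqr_ge0 c.
  have b0 := sqr_ge0 b; have d0 := sqr_ge0 d.
  have as' : a ^+ 2 <= s.
    by have := ler_piMl (ltW s0) s1; rewrite -expr2; lra.
  have cs : `|c| <= s.
    have cc : `|c| ^+ 2 = c ^+ 2 by rewrite real_normK ?num_real.
    have := normr_ge0 c; nra.
  have bc : `|beta * c| <= B * s by rewrite normrM ler_wpM2l.
  move: bc cs; rewrite !ler_norml => /andP[b1 b2] /andP[c1 c2].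
  have e1 : a ^+ 3 * a <= s * a ^+ 2 by rewrite -exprSr (exprD _ 2 2) ler_wpM2r.
  have e2 : c ^+ 2 * c <= s * c ^+ 2 by rewrite mulrC ler_wpM2r.
  have e3 : beta * c * a ^+ 2 <= B * s * a ^+ 2 by rewrite ler_wpM2r.
  have e4 : s * (2 + 4 * B) * a ^+ 2 <= lambda * a ^+ 2 by rewrite ler_wpM2r.
  have e5 : s * (2 + 4 * B) * c ^+ 2 <= lambda * c ^+ 2 by rewrite ler_wpM2r.
  have e6 : 0 <= B * s * c ^+ 2 by rewrite mulr_ge0// mulr_ge0// ltW.
  have e7 : 0 <= s * a ^+ 2 by rewrite mulr_ge0// ltW.
  have e8 : 0 <= s * c ^+ 2 by rewrite mulr_ge0// ltW.
  have e9 : 0 <= B * s * a ^+ 2 by rewrite mulr_ge0// mulr_ge0// ltW.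
  have e10 : 0 <= lambda * a ^+ 2 by rewrite mulr_ge0// ltW.
  have e11 : 0 <= lambda * c ^+ 2 by rewrite mulr_ge0// ltW.
  lra.
have pos x : 0 <= lambda / 4 * (u x ^+ 2 + v x ^+ 2).
  by rewrite mulr_ge0 ?addr_ge0 ?sqr_ge0// divr_ge0// ltW.
have /(Rint_eq0 l0 pos) z : \int[mu]_x (lambda / 4 * (u x ^+ 2 + v x ^+ 2)) = 0.
  by apply/eqP; rewrite eq_le le Rint_ge0.
have {}z : aev (fun x => u x = 0 /\ v x = 0).
  apply: (ae_mono z) => x /eqP; rewrite mulf_eq0 mulf_eq0 invr_eq0 pnatr_eq0.
  rewrite (gt_eqF lambda_gt0)/= paddr_eq0 ?sqr_ge0// !sqrf_eq0.
  by move=> /andP[/eqP -> /eqP ->].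
by split; apply: (ae_mono z) => x [] /=.
Qed.

End energy.

(** * Critical points solve the differential equation *)

Section regularity.
Context {R : realType}.
Local Notation mu := (@lebesgue_measure R).
Context (lambda beta : R) (lambda_gt0 : 0 < lambda).
Implicit Types (f g u v p q h k l m U P V Q Psi : R -> R) (x y a b c d M E : R).

Local Notation ndens := (ndens lambda).
Local Notation edens := (edens lambda).
Local Notation ddens := (ddens lambda beta).
Local Notation crit := (crit lambda beta).

(** By [oint_sqr] the primitive is Hoelder continuous of exponent $1/2$. *)
Lemma oint_cont g a : L2 g -> continuous (oint g a).
Proof.
move=> lg x; have lcg := L2_loc lg.
pose G := \int[mu]_x (g x ^+ 2).
have G0 : 0 <= G by apply: Rint_ge0 => y; exact: sqr_ge0.
apply/cvgrPdist_le => e e0; have G1 : 0 < G + 1 by rewrite ltr_wpDl.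
near=> y; have xy : `|x - y| < e ^+ 2 / (G + 1).
  near: y; apply/nbhs_ballP; exists (e ^+ 2 / (G + 1)) => //=.
  by rewrite divr_gt0// exprn_gt0.
have -> : oint g a x - oint g a y = oint g y x.
  by rewrite -(oint_chasles a y x lcg); ring.
have := oint_sqr y x lg; rewrite -/G; set o := oint g y x => oG.
have {xy} : `|x - y| * (G + 1) < e ^+ 2 by rewrite -ltr_pdivlMr.
move=> H; have d0 := normr_ge0 (x - y).
have oo : `|o| ^+ 2 = o ^+ 2 by rewrite real_normK ?num_real.
have := normr_ge0 o; nra.
Unshelve. all: by end_near. Qed.

(** Solved for the second derivatives, the system reads $u''=$ [reac1 u v], $v''=$ [reac2 u v]. *)
Definition reac1 a c : R := lambda * a - a ^+ 3 - beta * (a * c).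
Definition reac2 a c : R := lambda * c - 2^-1 * c ^+ 2 - 2^-1 * beta * a ^+ 2.

Lemma ddensE a b c d a' b' c' d' : ddens a b c d a' b' c' d' =
  (b * b' + reac1 a c * a') + (d * d' + reac2 a c * c').
Proof. by rewrite /ddens /reac1 /reac2; ring. Qed.

Lemma L2_reac1 u p v q : sob u p -> sob v q -> L2 (fun x => reac1 (u x) (v x)).
Proof.
move=> su sv; have [lu _ _] := su; have [lv _ _] := sv.
apply: L2B; last by apply: L2Z; exact: sob_L2M su lv.
apply: L2B; first exact: L2Z.
by apply: (L2_ext (sob_L2M su (sob_L2M su lu))) => x; ring.
Qed.

Lemma L2_reac2 u p v q : sob u p -> sob v q -> L2 (fun x => reac2 (u x) (v x)).
Proof.
move=> su sv; have [lu _ _] := su; have [lv _ _] := sv.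
apply: L2B; last first.
  by apply: L2Z; apply: (L2_ext (sob_L2M su lu)) => x; ring.
apply: L2B; first exact: L2Z.
by apply: L2Z; apply: (L2_ext (sob_L2M sv lv)) => x; ring.
Qed.

Definition ode U P V Q := forall x,
  [/\ isD U x (P x), isD P x (reac1 (U x) (V x)),
      isD V x (Q x) & isD Q x (reac2 (U x) (V x))].

(** The increments $(\phi,0)$ and $(0,\phi)$ with a test function $\phi$ separate the two
    equations. *)
Lemma crit_weak u p v q : sob u p -> sob v q -> crit u p v q ->
  is_weak_derivative p (fun x => reac1 (u x) (v x)) /\
  is_weak_derivative q (fun x => reac2 (u x) (v x)).
Proof.
move=> su sv C; have [lu lp _] := su; have [lv lq _] := sv.
have l1 := L2_reac1 su sv; have l2 := L2_reac2 su sv.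
split=> phi tp; have [lphi ldphi _] := sob_test tp.
  have := C _ _ _ _ (sob_test tp) sob0.
  under eq_Rintegral do rewrite ddensE !mulr0 !addr0.
  by rewrite Rint_add; [move/eqP; rewrite addr_eq0 => /eqP|exact: L2_mul|exact: L2_mul].
have := C _ _ _ _ sob0 (sob_test tp).
under eq_Rintegral do rewrite ddensE !mulr0 !add0r.
by rewrite Rint_add; [move/eqP; rewrite addr_eq0 => /eqP|exact: L2_mul|exact: L2_mul].
Qed.

(** All four functions have weak derivatives in $L^2$, so they agree almost everywhere with
    continuous primitives. The integrands of these primitives are then almost everywhere equal to
    continuous functions, and [isD_oint] differentiates them at every point. *)
Lemma crit_ode u p v q : sob u p -> sob v q -> crit u p v q ->
  exists U P V Q, [/\ ode U P V Q,
    aev (fun x => u x = U x /\ p x = P x) & aev (fun x => v x = V x /\ q x = Q x)].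
Proof.
move=> su sv C; have [w1 w2] := crit_weak su sv C.
have [lu lp wu] := su; have [lv lq wv] := sv.
have l1 := L2_reac1 su sv; have l2 := L2_reac2 su sv.
have [a1 ua] := weak_derivative_oint lu lp wu.
have [a2 va] := weak_derivative_oint lv lq wv.
have [b1 pa] := weak_derivative_oint lp l1 w1.
have [b2 qa] := weak_derivative_oint lq l2 w2.
pose U x := a1 + oint p 0 x; pose V x := a2 + oint q 0 x.
pose P x := b1 + oint (fun x => reac1 (u x) (v x)) 0 x.
pose Q x := b2 + oint (fun x => reac2 (u x) (v x)) 0 x.
have cst_cont (c : R) (g : R -> R) : continuous g -> continuous (fun x => c + g x).
  by move=> cg x; apply: cvgD; [exact: cvg_cst|exact: cg].
have cU : continuous U by apply: cst_cont; exact: oint_cont.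
have cV : continuous V by apply: cst_cont; exact: oint_cont.
have cP : continuous P by apply: cst_cont; exact: oint_cont.
have cQ : continuous Q by apply: cst_cont; exact: oint_cont.
have isDcst (c : R) g x y : isD g x y -> isD (fun x => c + g x) x y.
  by move=> gy; apply: isD_eq; [exact: isDD (isDc c x) gy|rewrite add0r].
have uv := ae_and ua va.
exists U, P, V, Q; split; last 2 first.
- exact: ae_and.
- exact: ae_and.
move=> x; split; apply: isDcst.
- by apply: isD_oint; [exact: L2_loc|exact: pa|exact: cP].
- apply: (@isD_oint _ _ (fun x => reac1 (U x) (V x))); first exact: L2_loc.
    by apply: (ae_mono uv) => y [-> ->].
  apply: cvgB; last by apply: cvgMr; apply: cvgM; [exact: cU|exact: cV].
  apply: cvgB; first by apply: cvgMr; exact: cU.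
  by apply: (@cvg_comp _ _ _ U (fun y => y ^+ 3) _ _ _ (cU x)); exact: exprn_continuous.
- by apply: isD_oint; [exact: L2_loc|exact: qa|exact: cQ].
- apply: (@isD_oint _ _ (fun x => reac2 (U x) (V x))); first exact: L2_loc.
    by apply: (ae_mono uv) => y [-> ->].
  apply: cvgB; last first.
    by apply: cvgMr; apply: (@cvg_comp _ _ _ U (fun y => y ^+ 2) _ _ _ (cU x)); exact: exprn_continuous.
  apply: cvgB; first by apply: cvgMr; exact: cV.
  by apply: cvgMr; apply: (@cvg_comp _ _ _ V (fun y => y ^+ 2) _ _ _ (cV x)); exact: exprn_continuous.
Qed.

(** The energy bound is stated as an oscillation bound on a primitive of the density: no
    integrability is presupposed, and every clause is checked pointwise. *)
Definition ode_energy U P V Q Psi E :=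
  [/\ ode U P V Q,
      forall x, isD Psi x (edens (U x) (P x) (V x) (Q x)) &
      forall x y, Psi x - Psi y <= E].

Lemma edens_ge0 a b c d : 0 <= edens a b c d.
Proof.
by rewrite addr_ge0// mulr_ge0// ?ndens_ge0// (exprM a 2 2) sqr_ge0.
Qed.

(** The second derivative of [Psi] along a solution; a bound on it lets the relation between [Psi]
    and the density pass to the limit. *)
Definition ode_dedens U P V Q x : R :=
  3^-1 * (P x * reac1 (U x) (V x) + lambda * (U x * P x)
    + (Q x * reac2 (U x) (V x) + lambda * (V x * Q x)))
  + 3^-1 * (U x ^+ 3 * P x).

Lemma isD_sqr f x a : isD f x a -> isD (fun y => f y ^+ 2) x (2 * (f x * a)).
Proof.
move=> fa; apply: isD_eq.
  exact: (isDcomp (f := fun y => y ^+ 2)) (isDX 2 _) fa.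
by rewrite /= expr1 mulrA.
Qed.

Lemma isD_edens U P V Q x : ode U P V Q ->
  isD (fun x => edens (U x) (P x) (V x) (Q x)) x (ode_dedens U P V Q x).
Proof.
move=> /(_ x)[dU dP dV dQ]; apply: isD_eq.
  apply: isDD; apply: isDZ.
    by apply: isDD; apply: isDD; try apply: isDZ; apply: isD_sqr; eassumption.
  exact: (isDcomp (f := fun y => y ^+ 4)) (isDX 4 _) dU.
by rewrite /ode_dedens /=; field.
Qed.

(** The density is nonnegative, so its integral over any interval is at most the total energy. The
    same [d] serves all bound states, which is what keeps a limit of them away from zero. *)
Lemma bound_state_ode : exists2 d, 0 < d & forall u v,
  bound_state lambda lambda beta (u, v) ->
  exists U P V Q Psi, ode_energy U P V Q Psi (Phi lambda lambda beta (u, v)) /\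
    exists x, d <= U x ^+ 2 + V x ^+ 2.
Proof.
have [d d0 dP] := crit_not_small beta lambda_gt0; exists d => // u v.
move=> /(bound_stateP _ lambda_gt0)[p [q [su sv nn C]]].
have [U [P [V [Q [Ho ua va]]]]] := crit_ode su sv C.
pose e x := edens (U x) (P x) (V x) (Q x).
have ce : continuous e by move=> x; exact: isD_cont (isD_edens x Ho).
have eae : aev (fun x => edens (u x) (p x) (v x) (q x) = e x).
  by apply: (ae_mono (ae_and ua va)) => x [[-> ->] [-> ->]].
have l1 := L1_edens lambda su sv.
have le : L1 e := L1_ae_eq (continuous_meas ce) l1 eae.
exists U, P, V, Q, (oint e 0); split; last first.
  apply: contrapT => nx; apply: (dP _ _ _ _ su sv nn C).
  apply: (ae_mono (ae_and ua va)) => x [[-> _] [-> _]].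
  by rewrite leNgt; apply/negP => dx; apply: nx; exists x; exact: ltW.
split=> // [x|x y].
  by apply: (@isD_oint _ _ e); [exact: L1_loc|exact: ae_all|exact: ce].
have -> : oint e 0 x - oint e 0 y = oint e y x.
  by rewrite -(oint_chasles 0 y x (L1_loc le)); ring.
rewrite (crit_energy su sv C) (Rint_ae_eq (L1_meas l1) (L1_meas le) eae).
apply: Rint_le => //; first exact: (L1_loc le).2.
move=> z; rewrite ler_piMr ?edens_ge0//.
exact: le_trans (ler_norm _) (chi_norm_le1 _ _ _).
Qed.

Lemma bound_state_energy_ge0 u v : bound_state lambda lambda beta (u, v) ->
  0 <= Phi lambda lambda beta (u, v).
Proof.
move=> /(bound_stateP _ lambda_gt0)[p [q [su sv nn C]]].
by rewrite (crit_energy su sv C); apply: Rint_ge0 => x; exact: edens_ge0.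
Qed.

(** The equation is autonomous. Subtracting [Psi a] normalises the new primitive to vanish at 0. *)
Lemma ode_energy_shift U P V Q Psi E a : ode_energy U P V Q Psi E ->
  ode_energy (fun x => U (x + a)) (fun x => P (x + a)) (fun x => V (x + a))
    (fun x => Q (x + a)) (fun x => Psi (x + a) - Psi a) E.
Proof.
have sh f x b : isD f (x + a) b -> isD (fun y => f (y + a)) x b.
  move=> fb; apply: isD_eq; first apply: (isDcomp (g := fun y => y + a) fb).
    by apply: isDD; [exact: isDid|exact: isDc].
  by rewrite addr0 mulr1.
move=> [Ho dPsi PE]; split=> [x|x|x y].
- by have [? ? ? ?] := Ho (x + a); split; exact: sh.
- apply: isD_eq; first by apply: isDB; [apply: sh; exact: dPsi|exact: isDc].
  by rewrite subr0.
- by rewrite opprB addrA subrK; exact: PE.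
Qed.

(* The oscillation of [F] is controlled by that of [Psi]; a large value of [F]
   somewhere would make [F], hence the density [e], large everywhere. *)
Lemma osc_bound (F F' e Psi : R -> R) (K E : R) :
  (forall x, isD F x (F' x)) -> (forall x, isD Psi x (e x)) -> 0 <= K ->
  (forall x, `|F' x| <= K * e x) -> (forall x, F x <= K * e x) ->
  (forall x y, Psi x - Psi y <= E) -> forall x, F x <= 2 * (K * E).
Proof.
move=> dF dPsi K0 F'e Fe PE x.
have osc y z : F z - F y <= K * E.
  have up : {homo (fun y => K * Psi y - F y) : a b / a <= b}.
    move=> a b ab; apply: (@isD_ndecr _ (fun y => K * Psi y - F y) (fun y => K * e y - F' y) a b _ _ ab) => w.
      by apply: isDB => //; exact: isDZ.
    by rewrite subr_ge0 (le_trans (ler_norm _)).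
  have dn : {homo (fun y => K * Psi y + F y) : a b / a <= b}.
    move=> a b ab; apply: (@isD_ndecr _ (fun y => K * Psi y + F y) (fun y => K * e y + F' y) a b _ _ ab) => w.
      by apply: isDD => //; exact: isDZ.
    by have := F'e w; rewrite ler_norml => /andP[]; lra.
  have p1 := ler_wpM2l K0 (PE z y); have p2 := ler_wpM2l K0 (PE y z).
  by case: (leP y z) => [/up|/ltW/dn]; lra.
(* Somewhere in $[0,1]$ the density equals [Psi 1 - Psi 0], hence is at most [E]; there [F] is at
   most [K * E], and the oscillation costs another [K * E]. *)
have [c _ ec] := MVT_isD dPsi (@ler01 R).
have := PE 1 0; rewrite ec subr0 mulr1 => /(ler_wpM2l K0) h.
by have := osc c x; have := Fe c; lra.
Qed.

(** [osc_bound] is applied to $U^2$ and $V^2$, whose derivatives are controlled by the density at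
    once. The resulting bound [B] makes the reaction terms at most linear in $|U|$ and $|V|$, and
    this opens the way to $P^2$ and $Q^2$. *)
Lemma ode_energy_bound E : exists2 M, 0 <= M & forall U P V Q Psi,
  ode_energy U P V Q Psi E ->
  forall x, [/\ `|U x| <= M, `|P x| <= M, `|V x| <= M & `|Q x| <= M].
Proof.
pose i := lambda^-1; have i0 : 0 < i by rewrite invr_gt0.
have li : lambda * i = 1 by rewrite divff// gt_eqF.
(* With this [K], $U^2+P^2+V^2+Q^2$ is at most [K] times the density. *)
pose K := 6 * (1 + i); have K0 : 0 <= K by rewrite /K; lra.
have Ke a b c d : a ^+ 2 + b ^+ 2 + c ^+ 2 + d ^+ 2 <= K * edens a b c d.
  have a40 : 0 <= a ^+ 4 by rewrite (exprM a 2 2) sqr_ge0.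
  have a2 := sqr_ge0 a; have b2 := sqr_ge0 b.
  have c2 := sqr_ge0 c; have d2 := sqr_ge0 d.
  have -> : K * edens a b c d =
    (1 + i) * (b ^+ 2 + d ^+ 2) + (lambda + lambda * i) * (a ^+ 2 + c ^+ 2)
     + K * 12^-1 * a ^+ 4 by rewrite /edens /ndens /K; field.
  rewrite li; have := mulr_ge0 (ltW i0) b2; have := mulr_ge0 (ltW i0) d2.
  have := mulr_ge0 (ltW lambda_gt0) a2; have := mulr_ge0 (ltW lambda_gt0) c2.
  have K12 : 0 <= K * 12^-1 by rewrite divr_ge0.
  by have := mulr_ge0 K12 a40; lra.
pose B := Num.sqrt (2 * (K * E)); have B0 : 0 <= B by exact: sqrtr_ge0.
pose L := lambda + B ^+ 2 + B + `|beta| * B.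
have L0 : 0 <= L.
  rewrite /L; have := mulr_ge0 (normr_ge0 beta) B0; have := sqr_ge0 B.
  by have := ltW lambda_gt0; lra.
(* The derivative of $Q^2$ is at most $2L|Q|(|U|+|V|)$, and each of the two products costs [L * K]
   times the density; the summand 1 covers $Q^2$ itself. *)
pose K' := (2 * L + 1) * K.
have K'0 : 0 <= K' by rewrite mulr_ge0//; lra.
exists (B + Num.sqrt (2 * (K' * E))); first by rewrite addr_ge0 ?sqrtr_ge0.
move=> U P V Q Psi [Ho dPsi PE] x.
have sq (F : R) A : F ^+ 2 <= A -> `|F| <= Num.sqrt A.
  by move=> FA; rewrite -sqrtr_sqr ler_wsqrtr.
have UB y : `|U y| <= B.
  apply: sq; apply: (osc_bound (F := fun x => U x ^+ 2) (F' := fun x => 2 * (U x * P x)) _ dPsi K0) => // z.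
  - by apply: isD_sqr; have [] := Ho z.
  - rewrite ler_norml; have := Ke (U z) (P z) (V z) (Q z).
    by have := sqr_ge0 (V z); have := sqr_ge0 (Q z); have := sqr_ge0 (U z - P z);
      have := sqr_ge0 (U z + P z); rewrite !sqrrD sqrrN mulrN; lra.
  - have := Ke (U z) (P z) (V z) (Q z).
    by have := sqr_ge0 (V z); have := sqr_ge0 (Q z); have := sqr_ge0 (P z); lra.
have VB y : `|V y| <= B.
  apply: sq; apply: (osc_bound (F := fun x => V x ^+ 2) (F' := fun x => 2 * (V x * Q x)) _ dPsi K0) => // z.
  - by apply: isD_sqr; have [] := Ho z.
  - rewrite ler_norml; have := Ke (U z) (P z) (V z) (Q z).
    by have := sqr_ge0 (U z); have := sqr_ge0 (P z); have := sqr_ge0 (V z - Q z);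
      have := sqr_ge0 (V z + Q z); rewrite !sqrrD sqrrN mulrN; lra.
  - have := Ke (U z) (P z) (V z) (Q z).
    by have := sqr_ge0 (U z); have := sqr_ge0 (Q z); have := sqr_ge0 (P z); lra.
have r1 y : `|reac1 (U y) (V y)| <= L * `|U y|.
  have -> : reac1 (U y) (V y) = (lambda - U y ^+ 2 - beta * V y) * U y.
    by rewrite /reac1; ring.
  rewrite normrM ler_wpM2r//.
  have h1 : U y ^+ 2 <= B ^+ 2.
    by rewrite -[U y ^+ 2]real_normK ?num_real// lerXn2r ?nnegrE.
  have h2 : `|beta * V y| <= `|beta| * B by rewrite normrM ler_wpM2l.
  have h3 := sqr_ge0 (U y); have h4 := ltW lambda_gt0.
  by move: h2; rewrite !ler_norml /L => /andP[]; lra.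
have r2 y : `|reac2 (U y) (V y)| <= L * `|V y| + L * `|U y|.
  have -> : reac2 (U y) (V y) =
      (lambda - 2^-1 * V y) * V y + (- (2^-1 * beta * U y)) * U y.
    by rewrite /reac2; ring.
  rewrite (le_trans (ler_normD _ _))// lerD// normrM ler_wpM2r//.
    have := VB y; rewrite !ler_norml /L => /andP[].
    have := sqr_ge0 B; have h4 := ltW lambda_gt0.
    by have := mulr_ge0 (normr_ge0 beta) B0; lra.
  have : `|beta * U y| <= `|beta| * B by rewrite normrM ler_wpM2l.
  rewrite !ler_norml /L => /andP[].
  have := sqr_ge0 B; have h4 := ltW lambda_gt0.
  by have := mulr_ge0 (normr_ge0 beta) B0; rewrite -mulrA; lra.
have prod (s t N : R) : `|t| <= N -> `|2 * (s * t)| <= 2 * (`|s| * N).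
  by move=> tN; rewrite !normrM ger0_norm// ler_pM2l// ler_wpM2l.
have PB y : `|P y| <= Num.sqrt (2 * (K' * E)).
  apply: sq; apply: (osc_bound (F := fun x => P x ^+ 2) (F' := fun x => 2 * (P x * reac1 (U x) (V x))) _ dPsi K'0) => // z.
  - by apply: isD_sqr; have [] := Ho z.
  - apply: le_trans (prod _ _ _ (r1 z)) _.
    have := Ke (U z) (P z) (V z) (Q z); rewrite /K' -mulrA.
    set A := K * _ => h.
    have nP : `|P z| ^+ 2 = P z ^+ 2 by rewrite real_normK ?num_real.
    have nU : `|U z| ^+ 2 = U z ^+ 2 by rewrite real_normK ?num_real.
    have s1 := sqr_ge0 (`|P z| - `|U z|); rewrite sqrrB nP nU in s1.
    have s2 : 2 * (`|P z| * `|U z|) <= A.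
      by have := sqr_ge0 (V z); have := sqr_ge0 (Q z); lra.
    have A0 : 0 <= A by apply: le_trans s2; rewrite !mulr_ge0.
    have := ler_wpM2l L0 s2; have := mulr_ge0 L0 A0; lra.
  - have := Ke (U z) (P z) (V z) (Q z); rewrite /K' -mulrA.
    set A := K * _ => h.
    have A0 : 0 <= A by apply: le_trans h; rewrite !addr_ge0 ?sqr_ge0.
    have := mulr_ge0 L0 A0; have := sqr_ge0 (V z); have := sqr_ge0 (Q z).
    by have := sqr_ge0 (U z); lra.
have QB y : `|Q y| <= Num.sqrt (2 * (K' * E)).
  apply: sq; apply: (osc_bound (F := fun x => Q x ^+ 2) (F' := fun x => 2 * (Q x * reac2 (U x) (V x))) _ dPsi K'0) => // z.
  - by apply: isD_sqr; have [] := Ho z.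
  - apply: le_trans (prod _ _ _ (r2 z)) _.
    have := Ke (U z) (P z) (V z) (Q z); rewrite /K' -mulrA.
    set A := K * _ => h.
    have nQ : `|Q z| ^+ 2 = Q z ^+ 2 by rewrite real_normK ?num_real.
    have nU : `|U z| ^+ 2 = U z ^+ 2 by rewrite real_normK ?num_real.
    have nV : `|V z| ^+ 2 = V z ^+ 2 by rewrite real_normK ?num_real.
    have s1 := sqr_ge0 (`|Q z| - `|U z|); rewrite sqrrB nQ nU in s1.
    have s2 := sqr_ge0 (`|Q z| - `|V z|); rewrite sqrrB nQ nV in s2.
    have s3 : 2 * (`|Q z| * `|U z|) <= A.
      by have := sqr_ge0 (V z); have := sqr_ge0 (P z); lra.
    have s4 : 2 * (`|Q z| * `|V z|) <= A.
      by have := sqr_ge0 (U z); have := sqr_ge0 (P z); lra.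
    have A0 : 0 <= A by apply: le_trans s3; rewrite !mulr_ge0.
    have := ler_wpM2l L0 s3; have := ler_wpM2l L0 s4; lra.
  - have := Ke (U z) (P z) (V z) (Q z); rewrite /K' -mulrA.
    set A := K * _ => h.
    have A0 : 0 <= A by apply: le_trans h; rewrite !addr_ge0 ?sqr_ge0.
    have := mulr_ge0 L0 A0; have := sqr_ge0 (V z); have := sqr_ge0 (P z).
    by have := sqr_ge0 (U z); lra.
split.
- by rewrite (le_trans (UB x))// lerDl sqrtr_ge0.
- by rewrite (le_trans (PB x))// lerDr.
- by rewrite (le_trans (VB x))// lerDl sqrtr_ge0.
- by rewrite (le_trans (QB x))// lerDr.
Qed.

End regularity.

(** * Compactness of solutions of bounded energy *)

Section compactness.
Context {R : realType}.
Context (lambda beta : R) (lambda_gt0 : 0 < lambda).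
Implicit Types (f g U P V Q Psi : R -> R) (x y a b c d M E : R).

Local Notation edens := (edens lambda).
Local Notation ode := (ode lambda beta).
Local Notation ode_energy := (ode_energy lambda beta).
Local Notation reac1 := (reac1 lambda beta).
Local Notation reac2 := (reac2 lambda beta).

Lemma MVT_isD_unordered f f' x y : (forall z, isD f z (f' z)) ->
  exists2 c, `|c - x| <= `|y - x| & f y - f x = f' c * (y - x).
Proof.
move=> df; have [xy|/ltW yx] := leP x y.
  have [c /andP[xc cy] e] := MVT_isD df xy; exists c => //.
  by rewrite !ger0_norm ?subr_ge0// lerB.
have [c /andP[yc cx] e] := MVT_isD df yx; exists c.
  by rewrite !ler0_norm ?subr_le0// lerN2 lerB.
by rewrite -[LHS]opprB e -mulrN opprB.
Qed.

Lemma taylor2 f f' f'' (C : R) x h : (forall z, isD f z (f' z)) ->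
  (forall z, isD f' z (f'' z)) -> (forall z, `|f'' z| <= C) ->
  `|f (x + h) - f x - h * f' x| <= C * h ^+ 2.
Proof.
move=> df df' fC; have C0 : 0 <= C := le_trans (normr_ge0 _) (fC 0).
have [c cx ->] := MVT_isD_unordered x (x + h) df.
have [d _ e] := MVT_isD_unordered x c df'.
have -> : f' c * (x + h - x) - h * f' x = h * (f' c - f' x) by ring.
rewrite e !normrM -real_normK ?num_real//.
have {}cx : `|c - x| <= `|h| by move: cx; rewrite addrAC subrr add0r.
have -> : C * `|h| ^+ 2 = `|h| * (C * `|h|) by ring.
by rewrite ler_wpM2l// ler_pM.
Qed.

Lemma cvg_exprn (S : Type) (F : set_system S) {FF : Filter F} (u : S -> R)
  (l : R) (n : nat) : u @ F --> l -> (fun s => u s ^+ n) @ F --> l ^+ n.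
Proof.
move=> ul; apply: (@cvg_comp _ _ _ u (fun y => y ^+ n) _ _ _ ul).
exact: exprn_continuous.
Qed.

Section limit_along_ultrafilter.
Context (T : set_system nat) (uT : UltraFilter T).

(** The image of [T] under [u] is an ultrafilter that contains the compact segment $[-M,M]$. *)
Lemma ultra_bounded_cvg (u : nat -> R) M : (forall n, `|u n| <= M) ->
  exists l : R, u @ T --> l.
Proof.
move=> uM; have pT : ProperFilter T by exact: ultra_proper.
have uu : UltraFilter (u @ T).
  split; first exact: fmap_proper_filter.
  move=> G pG sG; apply/seteqP; split => // A GA.
  have [//|TA] := in_ultra_setVsetC (u @^-1` A) uT.
  exfalso; have GAc : G (~` A) by exact: sG.
  have := @filter_not_empty _ G _; apply.
  by rewrite -(setICr A); exact: filterI.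
have := @segment_compact R (- M) M; rewrite compact_ultra => /(_ _ uu)[].
  by apply: nearW => n /=; rewrite in_itv/= -ler_norml.
by move=> l [_ ul]; exists l.
Qed.

Lemma isD_ultra_limit (F F1 F2 : nat -> R -> R) f g (C : R) :
  (forall n x, isD (F n) x (F1 n x)) -> (forall n x, isD (F1 n) x (F2 n x)) ->
  (forall n x, `|F2 n x| <= C) ->
  (forall x, F ^~ x @ T --> f x) -> (forall x, F1 ^~ x @ T --> g x) ->
  forall x, isD f x (g x).
Proof.
move=> dF dF1 F2C Ff F1g x; have pT : ProperFilter T by exact: ultra_proper.
apply: (@isD_quadratic _ _ _ _ C) => h.
have cv : (fun n => F n (x + h) - F n x - h * F1 n x) @ T -->
    f (x + h) - f x - h * g x.
  by apply: cvgB; [exact: cvgB|exact: cvgMr].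
apply: (cvgr_to_le (cvg_norm cv)); apply: nearW => n.
exact: taylor2.
Qed.

End limit_along_ultrafilter.

(** The second derivatives needed in [isD_ultra_limit] are polynomials in [U], [P], [V], [Q], so
    closure under the ring operations bounds them. *)
Definition unif_bd (F : nat -> R -> R) := exists C, forall n x, `|F n x| <= C.

Lemma unif_bdD F G : unif_bd F -> unif_bd G -> unif_bd (fun n x => F n x + G n x).
Proof.
move=> [C FC] [D GD]; exists (C + D) => n x.
by rewrite (le_trans (ler_normD _ _))// lerD.
Qed.

Lemma unif_bdB F G : unif_bd F -> unif_bd G -> unif_bd (fun n x => F n x - G n x).
Proof.
move=> [C FC] [D GD]; exists (C + D) => n x.
by rewrite (le_trans (ler_normB _ _))// lerD.
Qed.

Lemma unif_bdM F G : unif_bd F -> unif_bd G -> unif_bd (fun n x => F n x * G n x).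
Proof.
by move=> [C FC] [D GD]; exists (C * D) => n x; rewrite normrM ler_pM.
Qed.

Lemma unif_bdc c : unif_bd (fun=> fun=> c).
Proof. by exists `|c|. Qed.

Lemma unif_bdX F k : unif_bd F -> unif_bd (fun n x => F n x ^+ k).
Proof.
move=> [C FC]; exists (C ^+ k) => n x; rewrite normrX lerXn2r ?nnegrE//.
exact: le_trans (FC n x).
Qed.

Ltac bdd := repeat first [apply: unif_bdB | apply: unif_bdD | apply: unif_bdM |
  apply: unif_bdX | exact: unif_bdc | assumption].

Lemma ode_compact (U P V Q Psi : nat -> R -> R) (E : nat -> R) M m d :
  (forall n, ode_energy (U n) (P n) (V n) (Q n) (Psi n) (E n)) ->
  (forall n, Psi n 0 = 0) -> (forall n, E n <= M) ->
  (forall e, 0 < e -> \forall n \near \oo, E n <= m + e) ->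
  (forall n, d <= U n 0 ^+ 2 + V n 0 ^+ 2) ->
  exists U' P' V' Q' Psi', ode_energy U' P' V' Q' Psi' m /\
    d <= U' 0 ^+ 2 + V' 0 ^+ 2.
Proof.
move=> HE Psi0 EM Em Hd.
have [B B0 HB] := ode_energy_bound beta lambda_gt0 M.
have HM n : ode_energy (U n) (P n) (V n) (Q n) (Psi n) M.
  have [h1 h2 h3] := HE n; split => // x y.
  exact: le_trans (h3 x y) (EM n).
have bd n := HB _ _ _ _ _ (HM n).
(* [T] refines the filter of eventuality, so the eventual bounds [Em] remain available along it. *)
have [T [uT sT]] := ultraFilterLemma eventually_filter.
have pT : ProperFilter T by exact: ultra_proper.
have lim (F : nat -> R -> R) : (forall x, exists C, forall n, `|F n x| <= C) ->
    exists f : R -> R, forall x, F ^~ x @ T --> f x.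
  move=> HF; have H x : exists l : R, F ^~ x @ T --> l.
    by have [C FC] := HF x; exact: ultra_bounded_cvg FC.
  by have [f Hf] := choice H; exists f.
have [U' cU] : exists f : R -> R, forall x, U ^~ x @ T --> f x.
  by apply: lim => x; exists B => n; have [] := bd n x.
have [P' cP] : exists f : R -> R, forall x, P ^~ x @ T --> f x.
  by apply: lim => x; exists B => n; have [] := bd n x.
have [V' cV] : exists f : R -> R, forall x, V ^~ x @ T --> f x.
  by apply: lim => x; exists B => n; have [] := bd n x.
have [Q' cQ] : exists f : R -> R, forall x, Q ^~ x @ T --> f x.
  by apply: lim => x; exists B => n; have [] := bd n x.
have [Psi' cPsi] : exists f : R -> R, forall x, Psi ^~ x @ T --> f x.
  (* Since [Psi n] vanishes at 0, its oscillation bound is a bound on its values. *)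
  apply: lim => x; exists M => n; have [_ _ PE] := HM n.
  have := PE x 0; have := PE 0 x; rewrite Psi0 subr0 sub0r ler_norml.
  by move=> h1 h2; rewrite h2 andbT lerNl.
have bU : unif_bd U by exists B => n x; have [] := bd n x.
have bP : unif_bd P by exists B => n x; have [] := bd n x.
have bV : unif_bd V by exists B => n x; have [] := bd n x.
have bQ : unif_bd Q by exists B => n x; have [] := bd n x.
have O n x : [/\ isD (U n) x (P n x), isD (P n) x (reac1 (U n x) (V n x)),
   isD (V n) x (Q n x) & isD (Q n) x (reac2 (U n x) (V n x))].
  by have [h _ _] := HE n; exact: h.
have cr1 x : (fun n => reac1 (U n x) (V n x)) @ T --> reac1 (U' x) (V' x).
  apply: cvgB; last by apply: cvgMr; apply: cvgM.
  by apply: cvgB; [exact: cvgMr|exact: cvg_exprn].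
have cr2 x : (fun n => reac2 (U n x) (V n x)) @ T --> reac2 (U' x) (V' x).
  apply: cvgB; last by apply: cvgMr; exact: cvg_exprn.
  by apply: cvgB; apply: cvgMr => //; exact: cvg_exprn.
have ce x : (fun n => edens (U n x) (P n x) (V n x) (Q n x)) @ T -->
    edens (U' x) (P' x) (V' x) (Q' x).
  apply: cvgD; apply: cvgMr; last exact: cvg_exprn.
  by apply: cvgD; apply: cvgD; try apply: cvgMr; exact: cvg_exprn.
exists U', P', V', Q', Psi'; split; last first.
  have cv : (fun n => U n 0 ^+ 2 + V n 0 ^+ 2) @ T --> U' 0 ^+ 2 + V' 0 ^+ 2.
    by apply: cvgD; exact: cvg_exprn.
  apply: (cvgr_to_ge cv).
  exact: nearW.
split=> [x|x|x y]; first split.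
- have [C HC] : unif_bd (fun n x => reac1 (U n x) (V n x)) by rewrite /reac1; bdd.
  apply: (isD_ultra_limit uT (F := U) (F1 := P) (C := C)) => // n y.
  + by have [] := O n y.
  + by have [_ h _ _] := O n y; exact: h.
  + exact: HC.
(* This is the derivative of [reac1] along the solution, that is, the second derivative of [P n]. *)
- have [C HC] : unif_bd (fun n x => lambda * P n x - 3 * U n x ^+ 2 * P n x
      - beta * (P n x * V n x + U n x * Q n x)) by bdd.
  apply: (isD_ultra_limit uT (F := P) (F1 := fun n x => reac1 (U n x) (V n x))
    (g := fun x => reac1 (U' x) (V' x)) (C := C)) => // n y.
  + by have [] := O n y.
  + have [dU _ dV _] := O n y; apply: isD_eq.
      apply: isDB; last by apply: isDZ; apply: isDM; eassumption.
      apply: isDB; first by apply: isDZ; exact: dU.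
      exact: (isDcomp (f := fun y => y ^+ 3)) (isDX 3 _) dU.
    reflexivity.
  + exact: HC.
- have [C HC] : unif_bd (fun n x => reac2 (U n x) (V n x)) by rewrite /reac2; bdd.
  apply: (isD_ultra_limit uT (F := V) (F1 := Q) (C := C)) => // n y.
  + by have [] := O n y.
  + by have [_ _ _ h] := O n y; exact: h.
  + exact: HC.
- have [C HC] : unif_bd (fun n x => lambda * Q n x - 2^-1 * (2 * (V n x * Q n x))
      - 2^-1 * beta * (2 * (U n x * P n x))) by bdd.
  apply: (isD_ultra_limit uT (F := Q) (F1 := fun n x => reac2 (U n x) (V n x))
    (g := fun x => reac2 (U' x) (V' x)) (C := C)) => // n y.
  + by have [] := O n y.
  + have [dU _ dV _] := O n y; apply: isD_eq.
      apply: isDB; last by apply: isDZ; apply: isD_sqr; exact: dU.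
      apply: isDB; first by apply: isDZ; exact: dV.
      by apply: isDZ; apply: isD_sqr; exact: dV.
    reflexivity.
  + exact: HC.
- have [C HC] : unif_bd (fun n => ode_dedens lambda beta (U n) (P n) (V n) (Q n)).
    by rewrite /ode_dedens /reac1 /reac2; bdd.
  apply: (@isD_ultra_limit T uT Psi
    (fun n x => edens (U n x) (P n x) (V n x) (Q n x))
    (fun n => ode_dedens lambda beta (U n) (P n) (V n) (Q n)) Psi'
    (fun x => edens (U' x) (P' x) (V' x) (Q' x)) C).
  + by move=> n y; have [_ h _] := HE n; exact: h.
  + by move=> n y; apply: isD_edens => z; exact: O.
  + exact: HC.
  + exact: cPsi.
  + exact: ce.
- apply/ler_addgt0Pr => e e0.
  apply: (cvgr_to_le (cvgB (cPsi x) (cPsi y))).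
  apply: sT; apply: filterS (Em e e0) => n; apply: le_trans.
  by have [_ _ h] := HE n; exact: h.
Qed.

End compactness.

(** * Solutions of finite energy are bound states *)

Section classical_solutions.
Context {R : realType}.
Local Notation mu := (@lebesgue_measure R).
Context (lambda beta : R) (lambda_gt0 : 0 < lambda).
Implicit Types (f g h k l m U P V Q Psi : R -> R) (x y a b c d M E : R).

Local Notation edens := (edens lambda).
Local Notation ode := (ode lambda beta).
Local Notation ode_energy := (ode_energy lambda beta).
Local Notation reac1 := (reac1 lambda beta).
Local Notation reac2 := (reac2 lambda beta).

(** Monotone convergence along the truncations to $]-n,n]$. *)
Lemma ge0_L1 f E : continuous f -> (forall x, 0 <= f x) ->
  (forall n : nat, oint f (- n%:R) n%:R <= E) -> L1 f /\ \int[mu]_x f x <= E.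
Proof.
move=> cf f0 fE; have mf := continuous_meas cf.
pose g (n : nat) x : R := f x * chi (- n%:R) n%:R x.
have gE n x : g n x = f x * ((- n%:R < x) && (x <= n%:R))%:R.
  rewrite /g chiE ?indicE ?mem_setE ?in_itv//.
  by rewrite (@le_trans _ _ 0)// oppr_le0.
have lg n : L1 (g n) := (loc_continuous cf).2 _ _.
have g0 n x : 0 <= g n x by rewrite gE mulr_ge0.
have mg n : measurable_fun [set: measurableTypeR R] (EFin \o g n).
  by apply/measurable_EFinP; exact: L1_meas (lg n).
have nd x : {homo (fun n => (EFin \o g n) x) : n k / (n <= k)%N >-> (n <= k)%E}.
  move=> n k nk; rewrite lee_fin !gE ler_wpM2l// ler_nat.
  have nkR : n%:R <= k%:R :> R by rewrite ler_nat.
  case: (boolP ((- n%:R < x) && _)) => // /andP[x1 x2].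
  by rewrite (le_trans x2 nkR) (le_lt_trans _ x1)// lerN2.
have lim x : limn (fun n => (EFin \o g n) x) = (f x)%:E.
  apply/cvg_lim => //; apply: cvg_near_cst; near=> n.
  rewrite /= gE.
  have : `|x| < n%:R by near: n; exact: nbhs_infty_gtr.
  by rewrite ltr_norml => /andP[-> /ltW ->]; rewrite mulr1.
have cv := cvg_monotone_convergence (mu := mu) measurableT mg
  (fun n x _ => g0 n x) (fun x _ => nd x).
have If : (\int[mu]_x (f x)%:E <= E%:E)%E.
  under eq_integral do rewrite -lim.
  apply: (@cvge_to_le _ _ _ _ _ _ _ cv).
  apply: nearW => n; rewrite -(fineK (integrable_fin_num measurableT (lg n))).
  by rewrite lee_fin; exact: fE.
have If0 : (0 <= \int[mu]_x (f x)%:E)%E.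
  by apply: integral_ge0 => x _; rewrite lee_fin.
have lf : L1 f.
  apply/integrableP; split; first exact/measurable_EFinP.
  have -> : (\int[mu]_x `|(EFin \o f) x| = \int[mu]_x (f x)%:E)%E.
    by apply: eq_integral => x _; rewrite /= ger0_norm.
  by rewrite (le_lt_trans If)// ltry.
split => //; rewrite -lee_fin /Rintegral fineK//.
exact: (integrable_fin_num measurableT lf).
Unshelve. all: by end_near. Qed.

(** The derivatives are polynomials in the four functions, so all four gain one order together. Full
    smoothness is wanted because [P] times a cutoff must be a test function in [sob_ibp]. *)
Lemma smooth_ode U P V Q : ode U P V Q ->
  [/\ smooth U, smooth P, smooth V & smooth Q].
Proof.
move=> Ho; suff H n : [/\ Cn n U, Cn n P, Cn n V & Cn n Q].
  by split=> n; have [] := H n.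
elim: n => [//|n [cU cP cV cQ]].
have X2 f : Cn n f -> Cn n (fun x => f x ^+ 2).
  by move=> cf; exact: (CnM cf cf).
split.
- by apply: (@CnS_isD _ _ _ P) => // x; have [] := Ho x.
- apply: (@CnS_isD _ _ _ (fun x => reac1 (U x) (V x))).
    by move=> x; have [] := Ho x.
  apply: CnB; last by apply: CnZ; exact: CnM.
  apply: CnB; first exact: CnZ.
  have := CnM cU (X2 _ cU); congr Cn; apply/funext => x; by rewrite -exprS.
- by apply: (@CnS_isD _ _ _ Q) => // x; have [] := Ho x.
- apply: (@CnS_isD _ _ _ (fun x => reac2 (U x) (V x))).
    by move=> x; have [] := Ho x.
  apply: CnB; last by apply: CnZ; exact: X2.
  by apply: CnB; [exact: CnZ|apply: CnZ; exact: X2].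
Qed.

(* Integration by parts against an arbitrary Sobolev function: [P] times a cutoff
   is a test function, to which the definition of the weak derivative applies. *)
Lemma sob_ibp P f h k : smooth P -> (forall x, isD P x (f x)) -> L2 P -> L2 f ->
  sob h k -> \int[mu]_x (P x * k x + f x * h x) = 0.
Proof.
move=> sP dP lP lf [lh lk w]; have m0 := @bump_mass_gt0 R.
(* The transition width stays 1 while the plateau grows: the derivatives are then bounded uniformly
   in [n], and at each point they eventually vanish. *)
pose eta (n : nat) := @cutoff R 1 (- n%:R) n%:R.
pose deta (n : nat) := @dcutoff R 1 (- n%:R) n%:R.
have nn (n : nat) : - n%:R <= n%:R :> R by rewrite (@le_trans _ _ 0)// oppr_le0.
have deta_eta n x : isD (eta n) x (deta n x) := isD_cutoff _ _ _ _.
have seta n : smooth (eta n) := smooth_cutoff _ _ _.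
have t n : test_function (fun x => P x * eta n x).
  apply: (@support_test _ _ (- n%:R) (n%:R + 1^-1)).
    by move=> i; apply: CnM; [exact: sP|exact: seta].
  by move=> x H; rewrite /eta cutoff_out ?mulr0.
have dt n : derive1 (fun x => P x * eta n x) =
    (fun x => f x * eta n x + P x * deta n x).
  by apply: isD_derive1 => x; exact: isDM.
have eta1 n x : `|eta n x| <= 1.
  by rewrite ger0_norm ?cutoff_ge0// cutoff_le1.
have deta1 n x : `|deta n x| <= 2 * bump_mass^-1.
  have D y : 0 <= 1 * dstep y <= bump_mass^-1 by rewrite mul1r dstep_ge0 dstep_le.
  rewrite /deta /dcutoff ler_norml; have := D (1 * (x - - n%:R)).
  by have := D (1 * (x - n%:R)); lra.
have meta n : measurable_fun setT (eta n) := smooth_meas (seta n).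
have mdeta n : measurable_fun setT (deta n).
  have -> : deta n = derive1 (eta n) by rewrite (isD_derive1 (deta_eta n)).
  exact: smooth_meas (smooth_derive1 (seta n)).
have near_eta x : \forall n \near \oo, eta n x = 1 /\ deta n x = 0.
  near=> n.
  have xn : `|x| + 1 < n%:R by near: n; exact: nbhs_infty_gtr.
  have [x1 x2] : - n%:R + 1 < x /\ x < n%:R.
    by have := ler_norm x; have := ler_norm (- x); rewrite normrN; lra.
  rewrite /eta /deta /cutoff /dcutoff !mul1r opprK.
  rewrite step1 ?(@step0 _ (x - _))//; try lra.
  by rewrite !dstep_out ?subr0// ?subrr//; apply/orP; [left|right]; lra.
have c1 : (fun n => \int[mu]_x (k x * (P x * eta n x))) @ \oo -->
    \int[mu]_x (k x * P x).
  apply: (Rint_dominated_cvg _ _ (L1_norm (L2_mul lk lP))) => [n|||].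
  - by apply: measurable_funM; [exact: L2_meas|apply: measurable_funM => //; exact: L2_meas].
  - by apply: measurable_funM; exact: L2_meas.
  - move=> n; apply: ae_all => x; rewrite mulrA normrM ler_piMr//.
  - move=> x; apply: cvg_near_cst; apply: filterS (near_eta x) => n [-> _].
    by rewrite mulr1.
have c2 : (fun n => \int[mu]_x (h x * (f x * eta n x + P x * deta n x))) @ \oo -->
    \int[mu]_x (h x * f x).
  have lD : L1 (fun x => `|h x * f x| + (2 * bump_mass^-1) * `|h x * P x|).
    by apply: L1D; [|apply: L1Z]; apply: L1_norm; exact: L2_mul.
  apply: (Rint_dominated_cvg _ _ lD) => [n|||].
  - apply: measurable_funM; first exact: L2_meas.
    by apply: measurable_funD; apply: measurable_funM => //; exact: L2_meas.
  - by apply: measurable_funM; exact: L2_meas.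
  - move=> n; apply: ae_all => x; rewrite mulrDr (le_trans (ler_normD _ _))// lerD//.
      by rewrite mulrA normrM ler_piMr.
    by rewrite mulrA normrM mulrC ler_wpM2r.
  - move=> x; apply: cvg_near_cst; apply: filterS (near_eta x) => n [-> ->].
    by rewrite mulr1 mulr0 addr0.
have e n : \int[mu]_x (h x * (f x * eta n x + P x * deta n x)) =
   - \int[mu]_x (k x * (P x * eta n x)) by rewrite -(w _ (t n)) dt.
have {c2} c2 : (fun n => - \int[mu]_x (k x * (P x * eta n x))) @ \oo -->
    \int[mu]_x (h x * f x).
  by apply: cvg_trans c2; apply: near_eq_cvg; apply: nearW => n; rewrite /= e.
have H := cvg_unique (@Rhausdorff R) c2 (cvgN c1).
rewrite Rint_add; [|exact: L2_mul|exact: L2_mul].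
under eq_Rintegral do rewrite mulrC.
under [X in _ + X]eq_Rintegral do rewrite mulrC.
by rewrite H subrr.
Unshelve. all: by end_near. Qed.

(** The primitive of [f] has both derivatives $f(x)$ and 0 at [x]. *)
Lemma continuous_ae0 f : continuous f -> aev (fun x => f x = 0) ->
  forall x, f x = 0.
Proof.
move=> cf f0 x; have lf := loc_continuous cf.
have [_ <-] : isD (oint f 0) x (f x).
  by apply: (@isD_oint _ f f) => //; [exact: ae_all|exact: cf].
have [_ ->//] : isD (oint f 0) x 0.
by apply: (@isD_oint _ f (fun=> 0)) => //; exact: cvg_cst.
Qed.

(** The oscillation bound makes the density integrable, and the density dominates the squares of the
    four functions, which are thus in $L^2$. Integration by parts gives [crit], and [crit_energy]
    identifies the energy with the integral of the density. *)
Lemma ode_bound_state U P V Q Psi E : ode_energy U P V Q Psi E ->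
  0 < U 0 ^+ 2 + V 0 ^+ 2 ->
  bound_state lambda lambda beta (U, V) /\ Phi lambda lambda beta (U, V) <= E.
Proof.
move=> [Ho dPsi PE] nz; have [sU sP sV sQ] := smooth_ode Ho.
have [cU cP] := (smooth_cont sU, smooth_cont sP).
have [cV cQ] := (smooth_cont sV, smooth_cont sQ).
pose e x := edens (U x) (P x) (V x) (Q x).
have ce : continuous e by move=> x; exact: isD_cont (isD_edens x Ho).
have [le Ie] : L1 e /\ \int[mu]_x e x <= E.
  apply: ge0_L1 => // [x|n]; first exact: edens_ge0.
  by rewrite (oint_FTC _ _ dPsi ce); exact: PE.
have i0 : 0 < lambda^-1 by rewrite invr_gt0.
have eb a b c d : [/\ a ^+ 2 <= (6 * lambda^-1) * edens a b c d,
    b ^+ 2 <= 6 * edens a b c d, c ^+ 2 <= (6 * lambda^-1) * edens a b c d &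
    d ^+ 2 <= 6 * edens a b c d].
  have a40 : 0 <= a ^+ 4 by rewrite (exprM a 2 2) sqr_ge0.
  have [a2 b2] := (sqr_ge0 a, sqr_ge0 b); have [c2 d2] := (sqr_ge0 c, sqr_ge0 d).
  have la := mulr_ge0 (ltW lambda_gt0) a2; have lc := mulr_ge0 (ltW lambda_gt0) c2.
  have B : b ^+ 2 + lambda * a ^+ 2 + (d ^+ 2 + lambda * c ^+ 2) <= 6 * edens a b c d.
    by rewrite /edens /ndens; lra.
  have D z : lambda * z <= 6 * edens a b c d -> z <= (6 * lambda^-1) * edens a b c d.
    by move=> h; rewrite mulrAC ler_pdivlMr// mulrC.
  by split; try apply: D; lra.
have L2e (f : R -> R) C : continuous f -> (forall x, f x ^+ 2 <= C * e x) -> L2 f.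
  move=> cf fe; split; first exact: continuous_meas.
  apply: (L1_dom _ (L1Z C le)).
    by apply: measurable_funX; exact: continuous_meas.
  by move=> x; rewrite ger0_norm ?sqr_ge0.
have lU : L2 U by apply: (L2e _ (6 * lambda^-1)) => // x; have [] := eb (U x) (P x) (V x) (Q x).
have lP : L2 P by apply: (L2e _ 6) => // x; have [] := eb (U x) (P x) (V x) (Q x).
have lV : L2 V by apply: (L2e _ (6 * lambda^-1)) => // x; have [] := eb (U x) (P x) (V x) (Q x).
have lQ : L2 Q by apply: (L2e _ 6) => // x; have [] := eb (U x) (P x) (V x) (Q x).
have su : sob U P.
  split => // phi; apply: test_ibp => // x; by have [] := Ho x.
have sv : sob V Q.
  split => // phi; apply: test_ibp => // x; by have [] := Ho x.
have l1 := L2_reac1 lambda beta su sv; have l2 := L2_reac2 lambda beta su sv.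
have C : crit lambda beta U P V Q.
  move=> h k l m sh sl; have [lh lk _] := sh; have [ll lm _] := sl.
  under eq_Rintegral do rewrite ddensE.
  rewrite Rint_add; last 2 first.
  - by apply: L1D; exact: L2_mul.
  - by apply: L1D; exact: L2_mul.
  rewrite (sob_ibp sP _ lP l1 sh) ?(sob_ibp sQ _ lQ l2 sl) ?addr0//.
  + by move=> x; have [] := Ho x.
  + by move=> x; have [] := Ho x.
split; last by rewrite (crit_energy su sv C).
apply/(bound_stateP _ lambda_gt0); exists P, Q; split => //.
move=> [/= z1 z2].
have {}z1 : forall x, U x = 0.
  by apply: continuous_ae0 => //; apply: (ae_mono z1) => x; exact.
have {}z2 : forall x, V x = 0.
  by apply: continuous_ae0 => //; apply: (ae_mono z2) => x; exact.
by move: nz; rewrite z1 z2 expr0n addr0 ltxx.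
Qed.

End classical_solutions.

(** * Existence of a bound state, and of a ground state *)

Section soliton.
Context {R : realType}.
Context (k : R) (k_gt0 : 0 < k).
Implicit Types x y : R.

(** A decreasing logistic function. Its derivative is a polynomial in itself, so the equations for
    the soliton reduce to polynomial identities. *)
Definition sigm x : R := (1 + expR (k * x))^-1.

Lemma sigm_gt0 x : 0 < sigm x.
Proof. by rewrite invr_gt0 addr_gt0 ?expR_gt0. Qed.

Lemma sigm_lt1 x : sigm x < 1.
Proof. by rewrite invf_lt1 ?ltrDl ?expR_gt0// addr_gt0 ?expR_gt0. Qed.

Lemma isD_sigm x : isD sigm x (- k * (sigm x - sigm x ^+ 2)).
Proof.
have e0 : 0 < expR (k * x) := expR_gt0 _.
have de : isD (fun y => 1 + expR (k * y)) x (expR (k * x) * k).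
  apply: isD_eq.
    apply: isDD (isDc 1 x) _; apply: (isDcomp (f := expR) (g := fun y => k * y)).
      exact: is_derive_expR.
    by apply: isDZ; exact: isDid.
  by rewrite add0r mulr1.
have n0 : 1 + expR (k * x) != 0 by rewrite gt_eqF// addr_gt0.
apply: (isD_eq (@is_deriveV R (fun y => 1 + expR (k * y)) x _ 1 n0 de)).
by rewrite /sigm /GRing.scale/=; field.
Qed.

(* The profile 3 k^2 sech^2(k x / 2) written with the logistic function. *)
Definition soliton x : R := 12 * k ^+ 2 * (sigm x - sigm x ^+ 2).
Definition soliton' x : R :=
  - (12 * k ^+ 3) * ((1 - 2 * sigm x) * (sigm x - sigm x ^+ 2)).
(** A primitive of the density: with $\sigma$ as variable, $dx=-d\sigma/(k(\sigma-\sigma^2))$, and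
    what is integrated is $-24k^5(2\sigma-6\sigma^2+8\sigma^3-4\sigma^4)$. *)
Definition soliton_energy x : R :=
  - (24 * k ^+ 5) * (sigm x ^+ 2 - 2 * sigm x ^+ 3 + 2 * sigm x ^+ 4
    - 4 / 5 * sigm x ^+ 5).

Lemma isD_sigmX n x : isD (fun y => sigm y ^+ n) x
  (n%:R * sigm x ^+ n.-1 * (- k * (sigm x - sigm x ^+ 2))).
Proof. exact: (isDcomp (f := fun y => y ^+ n)) (isDX n _) (isD_sigm x). Qed.

Lemma soliton_ode_energy (beta : R) : exists E,
  ode_energy (k ^+ 2) beta (fun=> 0) (fun=> 0) soliton soliton' soliton_energy E.
Proof.
(* A crude constant: the powers of [sigm] lie in $[0,1]$, so the bracket in [soliton_energy]
   oscillates by less than 12, and only finiteness matters. *)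
exists (24 * k ^+ 5 * 12); split=> [x|x|x y]; first split.
- exact: isDc.
- by apply: isD_eq (isDc _ _) _; rewrite /reac1; ring.
- apply: isD_eq.
    by apply: isDZ; apply: isDB (isD_sigm x) (isD_sigmX 2 x).
  by rewrite /soliton' /=; ring.
- apply: isD_eq.
    apply: isDZ; apply: isDM; apply: isDB.
    + exact: isDc.
    + by apply: isDZ; exact: isD_sigm.
    + exact: isD_sigm.
    + exact: isD_sigmX 2 x.
  by rewrite /reac2 /soliton /=; field.
- apply: isD_eq.
    apply: isDZ; apply: isDB; last by apply: isDZ; exact: isD_sigmX 5 x.
    apply: isDD; last by apply: isDZ; exact: isD_sigmX 4 x.
    apply: isDB; first exact: isD_sigmX 2 x.
    by apply: isDZ; exact: isD_sigmX 3 x.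
  by rewrite /edens /ndens /soliton /soliton' /=; field.
- have H z n : 0 <= sigm z ^+ n <= 1.
    by rewrite exprn_ge0 ?exprn_ile1// ltW// ?sigm_gt0 ?sigm_lt1.
  rewrite /soliton_energy !mulNr opprK addrC -mulrBr.
  rewrite ler_pM2l; last by rewrite mulr_gt0// exprn_gt0.
  have := (H x 2, H x 3, H x 4, H x 5); have := (H y 2, H y 3, H y 4, H y 5).
  move: (sigm x ^+ 2) (sigm x ^+ 3) (sigm x ^+ 4) (sigm x ^+ 5).
  move: (sigm y ^+ 2) (sigm y ^+ 3) (sigm y ^+ 4) (sigm y ^+ 5).
  move=> a1 a2 a3 a4 b1 b2 b3 b4 [[[]]] /andP[? ?] /andP[? ?] /andP[? ?] /andP[? ?].
  move=> [[[]]] /andP[? ?] /andP[? ?] /andP[? ?] /andP[? ?]; lra.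
Qed.

Lemma soliton0_gt0 : 0 < soliton 0.
Proof.
rewrite /soliton mulr_gt0 ?mulr_gt0 ?exprn_gt0// expr2 -{1}[sigm 0]mulr1 -mulrBr.
by rewrite mulr_gt0 ?sigm_gt0// subr_gt0 sigm_lt1.
Qed.

End soliton.

Theorem mainTheorem3 (R : realType) (lambda1 lambda2 beta : R)
    (eq_lambda : lambda1 = lambda2) (lambda1_gt0 : 0 < lambda1)
    (beta_gt : 1 / 2 < beta) :
  exists w : (R -> R) * (R -> R), ground_state lambda1 lambda2 beta w.
Proof.
subst lambda2; move: lambda1_gt0; set lambda := lambda1 => l0.
have [d d0 dP] := bound_state_ode beta l0.
pose B := [set Phi lambda lambda beta w | w in bound_state lambda lambda beta].
have B0 : B !=set0.
  (* The soliton with parameter $k$ solves the system for $\lambda=k^2$. *)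
  have k0 : 0 < Num.sqrt lambda by rewrite sqrtr_gt0.
  have [E] := soliton_ode_energy k0 beta; rewrite sqr_sqrtr ?ltW// => oE.
  have [] := ode_bound_state l0 oE.
    by rewrite expr0n add0r exprn_gt0// soliton0_gt0.
  by move=> bs _; eexists; exists (fun=> 0, soliton (Num.sqrt lambda)).
have lB : lbound B 0 by move=> _ [[u v] /(bound_state_energy_ge0 l0) ? <-].
have iB : has_inf B by split => //; exists 0.
pose m := inf B.
have H (n : nat) : exists t : R * ((R -> R) * (R -> R) * (R -> R) * (R -> R) * (R -> R)),
  let: (E, (U, P, V, Q, Psi)) := t in
  [/\ ode_energy lambda beta U P V Q Psi E, Psi 0 = 0, E <= m + n.+1%:R^-1 &
      d <= U 0 ^+ 2 + V 0 ^+ 2].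
  have n0 : 0 < n.+1%:R^-1 :> R by rewrite invr_gt0.
  have [_ [[u v] bs <-] lt] := inf_adherent n0 iB.
  have [U [P [V [Q [Psi [oe [x dx]]]]]]] := dP _ _ bs.
  exists (Phi lambda lambda beta (u, v), (fun y => U (y + x), fun y => P (y + x),
    fun y => V (y + x), fun y => Q (y + x), fun y => Psi (y + x) - Psi x)).
  split; [exact: ode_energy_shift|by rewrite add0r subrr|exact: ltW|].
  by rewrite add0r.
have [t tP] := choice H.
have [|||||U [P [V [Q [Psi [oe dU]]]]]] := @ode_compact R lambda beta l0
  (fun n => (t n).2.1.1.1.1) (fun n => (t n).2.1.1.1.2) (fun n => (t n).2.1.1.2)
  (fun n => (t n).2.1.2) (fun n => (t n).2.2) (fun n => (t n).1) (m + 1) m d.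
- by move=> n; have := tP n; case: (t n) => E [[[[U P] V] Q] Psi] [].
- by move=> n; have := tP n; case: (t n) => E [[[[U P] V] Q] Psi] [].
- move=> n; have := tP n; case: (t n) => E [[[[U P] V] Q] Psi] [_ _ h _] /=.
  by rewrite (le_trans h)// lerD2l invf_le1// ler1n.
- move=> e e0; near=> n; have := tP n.
  case: (t n) => E [[[[U P] V] Q] Psi] [_ _ h _] /=.
  rewrite (le_trans h)// lerD2l invf_ple ?posrE//.
  have dn : e^-1 <= n%:R by near: n; exact: nbhs_infty_ger.
  by rewrite (le_trans dn)// ler_nat.
- by move=> n; have := tP n; case: (t n) => E [[[[U P] V] Q] Psi] [].
have [|bs Um] := ode_bound_state l0 oe; first exact: lt_le_trans dU.
exists (U, V); split => // z bz; apply: le_trans Um _.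
by apply: ge_inf; [exists 0|exists z].
Unshelve. all: by end_near. Qed.
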